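(* Let $K$ be a field and let $\Delta$ be a simplicial complex of dimension one with vertex set $\{x_1,\dots,x_n\}$ that is Cohen-Macaulay over $K$. Then the $(s_1,\dots,s_n)$-expansion $\Delta^{(s_1,\dots,s_n)}$ is Cohen-Macaulay over $K$ for all positive integers $s_1,\dots,s_n$.
   Context: Simplicial complexes are finite; $\mathcal{F}(\Delta)$ denotes the set of facets (maximal faces) of $\Delta$, and $[s]=\{1,\dots,s\}$. The dimension of $\Delta$ is $\max\{|F|-1: F\in\Delta\}$. Expansion: for a simplicial complex $\Delta$ with vertex set $\{x_1,\dots,x_n\}$ and positive integers $s_1,\dots,s_n$, the $(s_1,\dots,s_n)$-expansion $\Delta^{(s_1,\dots,s_n)}$ is the simplicial complex with vertex set $\{x_{11},\dots,x_{1s_1},x_{21},\dots,x_{2s_2},\dots,x_{n1},\dots,x_{ns_n}\}$ whose facets are exactly the sets $\{x_{i_1r_1},\dots,x_{i_kr_k}\}$ where $\{x_{i_1},\dots,x_{i_k}\}\in\mathcal{F}(\Delta)$ with $i_1<\cdots<i_k$ and $(r_1,\dots,r_k)\in[s_{i_1}]\times\cdots\times[s_{i_k}]$. A simplicial complex is Cohen-Macaulay over $K$ if its Stanley-Reisner ring (the polynomial ring over $K$ on its vertices modulo the Stanley-Reisner ideal, generated by the squarefree monomials of non-faces) is a Cohen-Macaulay ring. *)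

(* Defs.v *)
From HB Require Import structures.
From mathcomp Require Import all_boot all_order all_algebra.
From mathcomp Require Import generic_quotient ring_quotient ring.
From mathcomp Require Import boolp.
From mathcomp Require Import mpoly.

Set Implicit Arguments.
Unset Strict Implicit.
Unset Printing Implicit Defensive.

Import GRing.Theory.
Local Open Scope ring_scope.
Local Open Scope quotient_scope.

(* The localization of R at a prime P: pairs (a, s) with s outside P, where   *)
(* (a, s) ~ (b, t) iff u (a t - b s) = 0 for some u outside P.                *)
Module Localization.
Section Localization.
Variables (R : comNzRingType) (P : prime_idealr R).

Local Notation denom := {x : R | x \notin P}.
Local Notation frac := (R * denom)%type.

Lemma denom1_subproof : 1 \notin P.
Proof. by rewrite idealr1. Qed.
Definition denom1 : denom := Sub 1 denom1_subproof.

Lemma denomM_subproof (s t : denom) : val s * val t \notin P.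
Proof. by rewrite prime_idealrM negb_or (valP s) (valP t). Qed.
Definition denomM (s t : denom) : denom := Sub (val s * val t) (denomM_subproof s t).

Definition equivl (x y : frac) : bool :=
  `[< exists u : denom, val u * (x.1 * val y.2) = val u * (y.1 * val x.2) >].

Lemma equivlP x y :
  reflect (exists u : denom, val u * (x.1 * val y.2) = val u * (y.1 * val x.2))
          (equivl x y).
Proof. exact: asboolP. Qed.

Lemma equivl_refl : reflexive equivl.
Proof. by move=> x; apply/equivlP; exists denom1. Qed.

Lemma equivl_sym : ssrbool.symmetric equivl.
Proof. by move=> x y; apply/equivlP/equivlP => -[u e]; exists u. Qed.

Lemma equivl_trans : transitive equivl.
Proof.
move=> y x z /equivlP[u e] /equivlP[v f]; apply/equivlP.
exists (denomM (denomM u v) y.2) => /=.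
have -> : val u * val v * val y.2 * (x.1 * val z.2) =
  val u * (x.1 * val y.2) * (val v * val z.2).
  by ring.
have -> : val u * val v * val y.2 * (z.1 * val x.2) =
  val v * (z.1 * val y.2) * (val u * val x.2).
  by ring.
by rewrite e -f; ring.
Qed.

Canonical equivl_equiv := EquivRel equivl equivl_refl equivl_sym equivl_trans.

Definition type := {eq_quot equivl}.
HB.instance Definition _ : EqQuotient _ equivl type := EqQuotient.on type.
HB.instance Definition _ := Choice.on type.

Definition zerol : type := lift_cst type (0, denom1).
Definition onel : type := lift_cst type (1, denom1).
Canonical pi_zero_morph := PiConst zerol.
Canonical pi_one_morph := PiConst onel.

Definition addf (x y : frac) : frac :=
  (x.1 * val y.2 + y.1 * val x.2, denomM x.2 y.2).
Definition add := lift_op2 type addf.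
Definition oppf (x : frac) : frac := (- x.1, x.2).
Definition opp := lift_op1 type oppf.
Definition mulf (x y : frac) : frac := (x.1 * y.1, denomM x.2 y.2).
Definition mul := lift_op2 type mulf.

Lemma equivl_repr x :
  exists u : denom, val u * (x.1 * val (repr (\pi_type x)).2) =
                    val u * ((repr (\pi_type x)).1 * val x.2).
Proof. by apply/equivlP; have /eqmodP := esym (reprK (\pi_type x)). Qed.

Lemma pi_add : {morph \pi : x y / addf x y >-> add x y}.
Proof.
move=> x y; unlock add; apply/eqmodP/equivlP => /=.
have [u] := equivl_repr x; have [v] := equivl_repr y.
set x' := repr (\pi_type x); set y' := repr (\pi_type y) => /= f e.
exists (denomM u v) => /=; rewrite !mulrDl !mulrDr; congr (_ + _).
  have -> : sval u * sval v * (x.1 * sval y.2 * (sval x'.2 * sval y'.2)) =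
    sval u * (x.1 * sval x'.2) * (sval v * sval y.2 * sval y'.2).
    by ring.
  by rewrite e; ring.
have -> : sval u * sval v * (y.1 * sval x.2 * (sval x'.2 * sval y'.2)) =
  sval v * (y.1 * sval y'.2) * (sval u * sval x.2 * sval x'.2).
  by ring.
by rewrite f; ring.
Qed.
Canonical pi_add_morph := PiMorph2 pi_add.

Lemma pi_opp : {morph \pi : x / oppf x >-> opp x}.
Proof.
move=> x; unlock opp; apply/eqmodP/equivlP => /=.
have [u e] := equivl_repr x.
by exists u; rewrite !mulNr !mulrN e.
Qed.
Canonical pi_opp_morph := PiMorph1 pi_opp.

Lemma pi_mul : {morph \pi : x y / mulf x y >-> mul x y}.
Proof.
move=> x y; unlock mul; apply/eqmodP/equivlP => /=.
have [u] := equivl_repr x; have [v] := equivl_repr y.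
set x' := repr (\pi_type x); set y' := repr (\pi_type y) => /= f e.
exists (denomM u v) => /=.
have -> : sval u * sval v * (x.1 * y.1 * (sval x'.2 * sval y'.2)) =
  (sval u * (x.1 * sval x'.2)) * (sval v * (y.1 * sval y'.2)).
  by ring.
by rewrite e f; ring.
Qed.
Canonical pi_mul_morph := PiMorph2 pi_mul.

Lemma eq_frac (x y : frac) : x.1 = y.1 -> val x.2 = val y.2 -> x = y.
Proof. by case: x y => [a s] [b t] /= -> /val_inj ->. Qed.

Lemma addA : associative add.
Proof.
elim/quotW=> x; elim/quotW=> y; elim/quotW=> z; rewrite !piE.
congr (\pi _); apply: eq_frac => /=; last by rewrite mulrA.
by rewrite !mulrDl !mulrA addrA (mulrAC y.1) (mulrAC z.1).
Qed.

Lemma addC : commutative add.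
Proof.
elim/quotW=> x; elim/quotW=> y; rewrite !piE.
by congr (\pi _); apply: eq_frac => /=; [rewrite addrC | rewrite mulrC].
Qed.

Lemma add0 : left_id zerol add.
Proof.
elim/quotW=> x; rewrite !piE.
by congr (\pi _); apply: eq_frac => /=; rewrite ?mul0r ?mul1r ?mulr1 ?add0r.
Qed.

Lemma addN : left_inverse zerol opp add.
Proof.
elim/quotW=> x; apply/eqP; rewrite piE; apply/equivlP; exists denom1 => /=.
by rewrite mulr1 mulNr addNr mul0r.
Qed.

HB.instance Definition _ := GRing.isZmodule.Build type addA addC add0 addN.

Lemma mulA : associative mul.
Proof.
elim/quotW=> x; elim/quotW=> y; elim/quotW=> z; rewrite !piE.
by congr (\pi _); apply: eq_frac; rewrite /= mulrA.
Qed.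

Lemma mulC : commutative mul.
Proof.
elim/quotW=> x; elim/quotW=> y; rewrite !piE.
by congr (\pi _); apply: eq_frac; rewrite /= mulrC.
Qed.

Lemma mul1 : left_id onel mul.
Proof.
elim/quotW=> x; rewrite !piE.
by congr (\pi _); apply: eq_frac; rewrite /= mul1r.
Qed.

Lemma mulDl : left_distributive mul add.
Proof.
elim/quotW=> x; elim/quotW=> y; elim/quotW=> z; apply/eqP.
rewrite !piE; apply/equivlP; exists denom1 => /=; congr (_ * _).
rewrite !mulrDl; congr (_ + _).
  by ring.
by ring.
Qed.

Lemma nonzero1 : onel != zerol.
Proof.
rewrite piE; apply/equivlP => -[u] /=; rewrite !mulr1 mulr0 => u0.
by have := valP u; rewrite /= u0 idealr0.
Qed.

HB.instance Definition _ :=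
  GRing.Zmodule_isComNzRing.Build type mulA mulC mul1 mulDl nonzero1.

End Localization.
End Localization.
HB.export Localization.

Notation localization := Localization.type.

Section CohenMacaulay.
Variable R : comNzRingType.
Implicit Types (s : seq R) (d e : nat).

Definition gen_ideal s : {pred R} :=
  [pred x | `[< exists c : 'I_(size s) -> R, x = \sum_i c i * s`_i >]].

(* idealr_closed I entails that I is proper; the unit ideal is finitely       *)
(* generated anyway.                                                          *)
Definition noetherian : Prop :=
  forall I : {pred R}, idealr_closed I -> exists s, I =i gen_ideal s.

Definition maximal_ideal (M : {pred R}) : Prop :=
  idealr_closed M /\
  forall I : {pred R}, idealr_closed I -> {subset M <= I} -> {subset I <= M}.

Definition prime_chain d : Prop :=
  exists P : nat -> prime_idealr R, forall i, (i < d)%N ->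
    {subset P i <= P i.+1} /\ ~ {subset P i.+1 <= P i}.

Definition krull_dim d : Prop :=
  prime_chain d /\ forall e, prime_chain e -> (e <= d)%N.

Definition regular_seq s : Prop :=
  (forall i, (i < size s)%N -> forall x : R,
     s`_i * x \in gen_ideal (take i s) -> x \in gen_ideal (take i s)) /\
  1 \notin gen_ideal s.

(* When R is local, its maximal ideal is the set of nonunits. *)
Definition nonunit (x : R) : Prop := ~ exists y, y * x = 1.

Definition regular_in_max s : Prop :=
  {in s, forall x, nonunit x} /\ regular_seq s.

Definition local_depth d : Prop :=
  (exists2 s, size s = d & regular_in_max s) /\
  (forall s, regular_in_max s -> (size s <= d)%N).

(* To be used for R Noetherian local. *)
Definition local_cohen_macaulay : Prop :=
  exists2 d, krull_dim d & local_depth d.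

End CohenMacaulay.

(* P ranges over all maximal ideals, since these are prime. *)
Definition cohen_macaulay (R : comNzRingType) : Prop :=
  noetherian R /\
  forall P : prime_idealr R, maximal_ideal P ->
    local_cohen_macaulay (localization P).

(* Simplicial complexes whose vertex set is all of V. *)
Record simplicial_complex (V : finType) := Complex {
  faces :> {set {set V}};
  complex_set0 : set0 \in faces;
  complex_down : forall F G : {set V}, G \subset F -> F \in faces -> G \in faces;
  complex_vertex : forall v : V, [set v] \in faces
}.

Section Complex.
Variables (V : finType) (D : simplicial_complex V).

Definition facets : {set {set V}} := [set F | maxset [pred G | G \in faces D] F].

Definition complex_dim : int := (\max_(F in faces D) #|F|)%N%:Z - 1.

End Complex.

Section StanleyReisner.
Variables (K : fieldType) (V : finType) (D : simplicial_complex V).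

Definition squarefree_mon (F : {set V}) : {mpoly K[#|V|]} :=
  \prod_(v in F) 'X_(enum_rank v).

Definition SR_ideal : {pred {mpoly K[#|V|]}} :=
  gen_ideal [seq squarefree_mon F | F in ~: faces D].

Lemma SR_ideal_closed : idealr_closed SR_ideal.
Proof.
split.
- by apply/asboolP; exists (fun=> 0); rewrite big1 // => i _; rewrite mul0r.
- apply/asboolP => -[c] /(congr1 (meval (fun=> 0))).
  rewrite rmorph1 rmorph_sum big1 => [/eqP|i _]; first by rewrite oner_eq0.
  rewrite rmorphM /=; set x := _`_i.
  have /mapP[F] : x \in [seq squarefree_mon F | F in ~: faces D].
    exact: mem_nth.
  rewrite mem_enum inE => FD ->.
  have [F0|[v vF]] := set_0Vmem F; first by rewrite F0 complex_set0 in FD.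
  by rewrite rmorph_prod (bigD1 v) //= mevalXU mul0r mulr0.
- move=> a x y /asboolP[c ->] /asboolP[e ->]; apply/asboolP.
  exists (fun i => a * c i + e i); rewrite mulr_sumr -big_split.
  by apply: eq_bigr => i _; rewrite /= mulrDl mulrA.
Qed.

HB.instance Definition _ :=
  isIdealr.Build {mpoly K[#|V|]} SR_ideal SR_ideal_closed.

Definition SR_ring : comNzRingType := {ideal_quot SR_ideal}.

Definition cohen_macaulay_over : Prop := cohen_macaulay SR_ring.

End StanleyReisner.

Section Expansion.
Variables (n : nat) (D : simplicial_complex 'I_n) (s : 'I_n -> nat).
Hypothesis s_gt0 : forall i, (0 < s i)%N.

(* The vertex x_{ir} is the dependent pair of i and r : 'I_(s i). *)
Definition exp_vertex : finType := {i : 'I_n & 'I_(s i)}.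

Definition exp_facets : {set {set exp_vertex}} :=
  [set [set Tagged (fun i => 'I_(s i)) (r i) | i in G]
     | G : {set 'I_n} in facets D, r : {dffun forall i : 'I_n, 'I_(s i)}].

Definition exp_faces : {set {set exp_vertex}} :=
  [set F : {set exp_vertex} | [exists G in exp_facets, F \subset G]].

Lemma exp_facetsP (F : {set exp_vertex}) :
  reflect (exists2 G : {set 'I_n}, G \in facets D &
             exists r : forall i, 'I_(s i), F = [set Tagged _ (r i) | i in G])
          (F \in exp_facets).
Proof.
apply: (iffP imset2P) => [[G r GD _ ->]|[G GD [r ->]]].
  by exists G => //; exists (fun i => r i).
exists G [ffun i => r i] => //.
by apply: eq_imset => i; rewrite ffunE.
Qed.

Lemma face_facet (F : {set 'I_n}) : F \in D -> exists2 G, G \in facets D & F \subset G.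
Proof.
move=> FD; have [G mG FG] := @maxset_exists _ [pred G | G \in faces D] F FD.
by exists G; rewrite ?inE.
Qed.

Lemma exp_cover i (x : 'I_(s i)) (F : {set 'I_n}) : i \in F -> F \in facets D ->
  exists2 G, G \in exp_facets & Tagged (fun i => 'I_(s i)) x \in G.
Proof.
move=> iF FD; pose r := dfwith (fun i => Ordinal (s_gt0 i)) x.
exists [set Tagged _ (r i) | i in F].
  by apply/exp_facetsP; exists F => //; exists r.
by apply/imsetP; exists i; rewrite // /r dfwith_in.
Qed.

Lemma exp_set0 : set0 \in exp_faces.
Proof.
have [F FD _] := face_facet (complex_set0 D).
rewrite inE; apply/existsP; exists [set Tagged _ (Ordinal (s_gt0 i)) | i in F].
rewrite sub0set andbT; apply/exp_facetsP; exists F => //.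
by exists (fun i => Ordinal (s_gt0 i)).
Qed.

Lemma exp_down (F G : {set exp_vertex}) :
  G \subset F -> F \in exp_faces -> G \in exp_faces.
Proof.
move=> GF; rewrite !inE => /existsP[H /andP[HD FH]].
by apply/existsP; exists H; rewrite HD (subset_trans GF).
Qed.

Lemma exp_singleton (v : exp_vertex) : [set v] \in exp_faces.
Proof.
case: v => i x; have [F FD iF] := face_facet (complex_vertex D i).
rewrite sub1set in iF; have [G GD xG] := exp_cover x iF FD.
by rewrite inE; apply/existsP; exists G; rewrite GD sub1set.
Qed.

Definition expansion : simplicial_complex exp_vertex :=
  Complex exp_set0 exp_down exp_singleton.

Lemma facets_expansion : facets expansion = exp_facets.
Proof.
have sub F : F \in exp_facets -> F \in exp_faces.
  by move=> FE; rewrite inE; apply/existsP; exists F; rewrite FE subxx.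
apply/setP => F; rewrite inE; apply/maxsetP/idP => [[]|FE].
  rewrite /= inE => /existsP[G /andP[GE FG]] maxF.
  by rewrite -(maxF G) //; apply: sub.
split=> [|G]; first exact: sub.
rewrite /= inE => /existsP[H /andP[HE GH]] FG; apply/eqP; rewrite eqEsubset FG andbT.
suff -> : F = H by [].
have FH := subset_trans FG GH.
have /exp_facetsP[A AD [r rF]] := FE; have /exp_facetsP[B BD [t tH]] := HE.
have AB : A \subset B.
  apply/subsetP => i iA.
  have : Tagged _ (r i) \in H by rewrite (subsetP FH) // rF; apply/imsetP; exists i.
  by rewrite tH => /imsetP[j jB /(congr1 tag)/= ->].
have eBA : B = A.
  move: AD BD; rewrite !inE => /maxsetP[_ maxA] /maxsetP[BD _].
  exact: maxA.
apply/eqP; rewrite eqEcard FH rF tH eBA !card_imset ?leqnn //.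
all: by move=> i j /(congr1 tag).
Qed.

End Expansion.

(* Main.v *)
(* For a complex of dimension 1, K[D] is Cohen-Macaulay iff D is connected as a
   graph, and expanding the vertices of a connected graph with at least two
   vertices leaves it connected.

   If D splits as A + B without an edge in between, no regular sequence at the
   origin has length 2, although the dimension there is 2.

   Conversely let D be connected and let R = K[D]. Counting monomials, any three
   a, b, c in R are algebraically dependent over K; isolating the lowest term of a
   relation gives a^i (b^j (c^k (1 + c z) + b y) + a x) = 0, which passes to the
   localizations and bounds by 2 both the length of a chain of primes and that of
   a regular sequence. Let theta and eta be the sum of the vertices and the sum of
   the edges. Every variable v satisfies v^3 - theta v^2 + eta v = 0, so by the
   argument of Zariski's lemma each maximal ideal contains p(theta) and q(eta) for
   some nonzero p, q in K[X]. These form a regular sequence: if p(theta) divides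
   q(eta) g in R, it divides g on every edge, and the quotients agree on common
   vertices since p(theta) does not vanish there, and at the origin by
   connectedness, so they glue. Finally a regular sequence a, b inside a prime P
   yields a chain of primes P0 < P1 < P with P1 containing a and avoiding the powers
   of b, and P0 inside P1 avoiding the powers of a. *)
From HB Require Import structures.
Require Import Defs.
From mathcomp Require Import all_boot all_order all_algebra.
From mathcomp Require Import generic_quotient ring_quotient ring zify.
From mathcomp Require Import boolp.
From mathcomp Require classical_sets.
From mathcomp Require Import mpoly.
Set Implicit Arguments.
Unset Strict Implicit.
Unset Printing Implicit Defensive.
Import GRing.Theory.
Local Open Scope ring_scope.
Local Open Scope quotient_scope.

(** * Ideals, primes and dimension *)

Section Ideals.
Variable R : comNzRingType.

(** Indexing the coefficients by [nat] keeps their type independent of the length of [s]. *)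
Lemma gen_idealP (s : seq R) x :
  reflect (exists c : nat -> R, x = \sum_(i < size s) c i * s`_i) (x \in gen_ideal s).
Proof.
apply: (iffP (asboolP _)) => [[c ->]|[c ->]]; last by exists (fun i => c i).
exists (fun k => if insub k is Some i then c i else 0).
by apply: eq_bigr => i _; rewrite valK.
Qed.

Lemma gen_ideal0 (s : seq R) : 0 \in gen_ideal s.
Proof. by apply/gen_idealP; exists (fun=> 0); rewrite big1 // => i _; rewrite mul0r. Qed.

Lemma gen_idealD (s : seq R) a : {in gen_ideal s &, forall u v, a * u + v \in gen_ideal s}.
Proof.
move=> u v /gen_idealP[c ->] /gen_idealP[e ->]; apply/gen_idealP.
exists (fun i => a * c i + e i); rewrite mulr_sumr -big_split.
by apply: eq_bigr => i _; rewrite mulrDl mulrA.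
Qed.

Lemma gen_ideal_mem (s : seq R) x : x \in s -> x \in gen_ideal s.
Proof.
move=> xs; apply/gen_idealP; exists (fun i => (i == index x s)%:R).
have ix : (index x s < size s)%N by rewrite index_mem.
rewrite (bigD1 (Ordinal ix)) //= eqxx mul1r nth_index // big1 ?addr0 // => i.
by rewrite -val_eqE /= => /negPf->; rewrite mul0r.
Qed.

(** Induction principle for membership. The predicate [I] may hold at 1, which [idealr_closed] would
    forbid. *)
Lemma gen_ideal_min (I : R -> Prop) (s : seq R) :
  I 0 -> (forall a u v, I u -> I v -> I (a * u + v)) ->
  (forall x, x \in s -> I x) -> forall x, x \in gen_ideal s -> I x.
Proof.
move=> I0 ID Is x /gen_idealP[c ->].
elim/big_ind: _ => // [u v Iu Iv|i _]; first by rewrite -[u]mul1r; apply: ID.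
by rewrite -[_ * _]addr0; apply: ID => //; apply/Is/mem_nth.
Qed.

Lemma gen_ideal_nilP x : (x \in gen_ideal ([::] : seq R)) = (x == 0).
Proof.
apply/gen_idealP/eqP => [[c ->]|->]; first by rewrite big_ord0.
by exists (fun=> 0); rewrite big_ord0.
Qed.

Lemma gen_ideal1P (a x : R) : reflect (exists c, x = c * a) (x \in gen_ideal [:: a]).
Proof.
apply: (iffP (gen_idealP _ _)) => [[c ->]|[c ->]].
  by exists (c 0%N); rewrite big_ord1.
by exists (fun=> c); rewrite big_ord1.
Qed.

Lemma gen_ideal2P (a b x : R) :
  reflect (exists c e, x = c * a + e * b) (x \in gen_ideal [:: a; b]).
Proof.
apply: (iffP (gen_idealP _ _)) => [[c ->]|[c [e ->]]].
  by exists (c 0%N), (c 1%N); rewrite big_ord_recl big_ord1.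
by exists (fun i => if i is 0 then c else e); rewrite big_ord_recl big_ord1.
Qed.

Lemma prime_idealr_of (Q : {pred R}) : idealr_closed Q -> prime_idealr_closed Q ->
  {P : prime_idealr R | P =i Q}.
Proof.
move=> Qi Qp.
pose P : prime_idealr R := HB.pack (Q : R -> bool) (isIdealr.Build R Q Qi)
  (isPrimeIdealrClosed.Build R Q Qp).
by exists P.
Qed.

(* Krull: an ideal maximal among those avoiding a multiplicative set is prime. *)
Lemma prime_avoiding (I S : R -> Prop) :
    I 0 -> (forall a u v, I u -> I v -> I (a * u + v)) ->
    S 1 -> (forall x y, S x -> S y -> S (x * y)) -> (forall x, I x -> S x -> False) ->
  exists P : prime_idealr R, (forall x, I x -> x \in P) /\ (forall x, S x -> x \notin P).
Proof.
move=> I0 ID S1 SM IS.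
pose idl (A : R -> Prop) := A 0 /\ forall a u v, A u -> A v -> A (a * u + v).
pose good A := idl A /\ forall x, A x -> S x -> False.
(* Zorn is applied to the sets [A] whose union with [I] is an ideal missing [S]; in this form the
   empty chain, whose union is empty, is covered by [I] itself. *)
have [|A [[[A0 AD] AS] maxA]] :=
    @classical_sets.Zorn_bigcup R (fun A => good (fun x => A x \/ I x)).
  move=> F FP tot; split; first split; first by right.
    move=> a u v [[X FX Xu]|Iu] [[Y FY Yv]|Iv].
    - have [XY|YX] := tot _ _ FX FY.
        have [[_ D] _] := FP _ FY.
        by have [|?] := D a u v (or_introl (XY _ Xu)) (or_introl Yv); [left; exists Y|right].
      have [[_ D] _] := FP _ FX.
      by have [|?] := D a u v (or_introl Xu) (or_introl (YX _ Yv)); [left; exists X|right].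
    - have [[_ D] _] := FP _ FX.
      by have [|?] := D a u v (or_introl Xu) (or_intror Iv); [left; exists X|right].
    - have [[_ D] _] := FP _ FY.
      by have [|?] := D a u v (or_intror Iu) (or_introl Yv); [left; exists Y|right].
    - by right; apply: ID.
  move=> x [[X FX Xx]|Ix] Sx; last exact: IS Sx.
  by have [_ d] := FP _ FX; apply: (d x) => //; left.
pose B x := A x \/ I x.
(* By maximality, the ideal generated by [B] and [u] meets [S]. *)
have ext u : ~ B u -> exists b r, B b /\ S (b + r * u).
  move=> Bu; pose C x := exists b r, B b /\ x = b + r * u.
  have BC x : B x -> C x by move=> Bx; exists x, 0; rewrite mul0r addr0.
  have Cu : C u by exists 0, 1; rewrite mul1r add0r.
  apply: contrapT => nS; apply: (maxA C).
    split=> [x Ax|CA]; first by apply: BC; left.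
    by apply: Bu; left; apply: CA.
  split; first split; first by right.
    move=> a x y Cx Cy; left.
    have {Cx}[b [r [Bb ->]]] : C x by case: Cx => // Ix; apply: BC; right.
    have {Cy}[c [t [Bc ->]]] : C y by case: Cy => // Iy; apply: BC; right.
    by exists (a * b + c), (a * r + t); split; [exact: AD|ring].
  move=> x [[b [r [Bb ->]]]|Ix] Sx; last exact: IS Sx.
  by apply: nS; exists b, r.
pose Q : {pred R} := [pred x | `[< B x >]].
have Qi : idealr_closed Q.
  split; [exact/asboolP| |by move=> a u v /asboolP Bu /asboolP Bv; apply/asboolP/AD].
  by apply/asboolP => B1; apply: (AS 1).
have Qp : prime_idealr_closed Q.
  move=> u v /asboolP Buv; apply/orP; apply: contrapT => /not_orP[].
  move=> nu nv.
  have [|b [r [Bb Sb]]] := @ext u; first by move=> /asboolP.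
  have [|c [t [Bc Sc]]] := @ext v; first by move=> /asboolP.
  apply: (AS _ _ (SM _ _ Sb Sc)).
  have -> : (b + r * u) * (c + t * v) = (c + t * v) * b + (r * u * c + (r * t) * (u * v)).
    by ring.
  by do 2!apply: (AD) => //; rewrite -[_ * _]addr0; apply: AD.
have [P PQ] := prime_idealr_of Qi Qp.
exists P; split=> x; first by move=> Ix; rewrite PQ; apply/asboolP; right.
by move=> Sx; rewrite PQ; apply/asboolP => Bx; apply: AS Bx Sx.
Qed.

(* The algebraic reformulation, due to Lombardi and Coquand, of having Krull
   dimension at most 2. *)
Definition dim_le2 := forall a b c : R, exists i j k x y z,
  a ^+ i * (b ^+ j * (c ^+ k * (1 + c * z) + b * y) + a * x) = 0.

Lemma prime_idealrX (P : prime_idealr R) x n : x ^+ n \in P -> x \in P.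
Proof.
elim: n => [|n IH]; first by rewrite expr0 idealr1.
by rewrite exprS prime_idealrM => /orP[].
Qed.

(** In a longer chain choose [a], [b], [c] in the successive differences and peel the relation from
    outside: [a ^+ i] is outside [P 0], so its cofactor lies in [P 0], and dropping [a * x] moves to
    [P 1]. Two more rounds put 1 into [P 3]. *)
Lemma dim_le2_chain e : dim_le2 -> @prime_chain R e -> (e <= 2)%N.
Proof.
move=> dimR [P chP]; rewrite leqNgt; apply/negP => e3.
have step i : (i < 3)%N -> exists2 x, x \in P i.+1 & x \notin P i.
  move=> i3; have [_ nPi] := chP i (leq_trans i3 e3).
  apply: contrapT => nx; apply: nPi => x xP; apply: contrapT => /negP xP'.
  by apply: nx; exists x.
have [a a1 a0] := step 0%N isT; have [b b2 b1] := step 1%N isT; have [c c3 c2] := step 2%N isT.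
have s12 : {subset P 1%N <= P 2%N} by have [] := chP 1%N (ltnW e3).
have s23 : {subset P 2%N <= P 3%N} by have [] := chP 2%N e3.
have s01 : {subset P 0%N <= P 1%N} by have [] := chP 0%N (ltnW (ltnW e3)).
have [i [j [k [x [y [z abc]]]]]] := dimR a b c.
have := idealr0 (P 0%N); rewrite -abc prime_idealrM => /orP[/prime_idealrX|].
  by rewrite (negPf a0).
move=> /s01 h1.
have h2 : b ^+ j * (c ^+ k * (1 + c * z) + b * y) \in P 1%N.
  by rewrite -(addrK (a * x) (b ^+ j * _)) rpredB // mulrC idealMr.
have {}h2 : c ^+ k * (1 + c * z) + b * y \in P 2%N.
  by apply: s12; move: h2; rewrite prime_idealrM => /orP[/prime_idealrX|//]; rewrite (negPf b1).
have : c ^+ k * (1 + c * z) \in P 2%N.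
  by rewrite -(addrK (b * y) (c ^+ k * _)) rpredB // mulrC idealMr.
rewrite prime_idealrM => /orP[/prime_idealrX|/s23 h]; first by rewrite (negPf c2).
by have := idealr1 (P 3%N); rewrite -(addrK (c * z) 1) rpredB // mulrC idealMr.
Qed.

Lemma regular_seqX (s : seq R) i n x : regular_seq s -> (i < size s)%N ->
  s`_i ^+ n * x \in gen_ideal (take i s) -> x \in gen_ideal (take i s).
Proof.
move=> [reg _] si; elim: n => [|n IH]; first by rewrite mul1r.
by rewrite exprS -mulrA => /(reg _ si)/IH.
Qed.

(** The relation is peeled as for chains of primes, with the ideals of the initial segments of [s]
    in place of the primes: regularity cancels the powers, and the tail terms die one segment
    later. *)
Lemma dim_le2_regular_seq (s : seq R) : dim_le2 -> regular_seq s -> (size s <= 2)%N.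
Proof.
move=> dimR regs; rewrite leqNgt; apply/negP => s3.
have [i [j [k [x [y [z abc]]]]]] := dimR s`_0 s`_1 s`_2.
have mul m l u : (m < l)%N -> (m < 3)%N -> s`_m * u \in gen_ideal (take l s).
  move=> ml m3; rewrite mulrC -[_ * _]addr0; apply: gen_idealD (gen_ideal0 _).
  apply: gen_ideal_mem; rewrite -(nth_take _ ml) mem_nth //.
  by rewrite size_take_min leq_min ml (leq_trans m3).
have mono l : {subset gen_ideal (take l s) <= gen_ideal (take l.+1 s)}.
  apply: gen_ideal_min => [|a u v|u ul]; [exact: gen_ideal0|exact: gen_idealD|].
  apply: gen_ideal_mem; have := take_takel s (leqnSn l).
  by move=> e; move: ul; rewrite -e => /mem_take.
have sub l u v : u + v \in gen_ideal (take l s) -> v \in gen_ideal (take l s) ->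
    u \in gen_ideal (take l s).
  move=> uv v'; rewrite -(addrK v u) addrC -mulN1r; exact: gen_idealD.
have h0 : s`_0 ^+ i * (s`_1 ^+ j * (s`_2 ^+ k * (1 + s`_2 * z) + s`_1 * y) + s`_0 * x)
    \in gen_ideal (take 0 s) by rewrite abc gen_ideal0.
have /mono/sub h1 := regular_seqX regs (ltnW (ltnW s3)) h0.
have /mono/sub h2 := regular_seqX regs (ltnW s3) (h1 (mul 0%N 1%N _ isT isT)).
have /mono/sub h3 := regular_seqX regs s3 (h2 (mul 1%N 2%N _ isT isT)).
have {}h3 := h3 (mul 2%N 3%N _ isT isT).
have [_ /negP] := regs; apply; move: 1 h3.
apply: gen_ideal_min => [|a u v|u ul]; [exact: gen_ideal0|exact: gen_idealD|].
by apply: gen_ideal_mem; apply: mem_take ul.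
Qed.

End Ideals.

(** * Localization at a prime *)

Section LocalRing.
Variables (R : comNzRingType) (P : prime_idealr R).
Local Notation T := (localization P).

Definition to_loc (r : R) : T := \pi_T (r, Localization.denom1 P).

Lemma locD (x y : R * {x : R | x \notin P}) :
  \pi_T x + \pi_T y = \pi_T (Localization.addf x y).
Proof. by rewrite -[_ + _]/(Localization.add _ _) -Localization.pi_add. Qed.

Lemma locM (x y : R * {x : R | x \notin P}) :
  \pi_T x * \pi_T y = \pi_T (Localization.mulf x y).
Proof. by rewrite -[_ * _]/(Localization.mul _ _) -Localization.pi_mul. Qed.

Lemma loc1 : 1 = to_loc 1.
Proof. by rewrite -[LHS]/(Localization.onel P) piE. Qed.

Lemma to_loc_is_zmod_morphism : zmod_morphism to_loc.
Proof.
have D x y : to_loc (x + y) = to_loc x + to_loc y.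
  by rewrite locD; congr (\pi_T _); apply: Localization.eq_frac; rewrite /= !mulr1.
by move=> x y; apply: (addIr (to_loc y)); rewrite -D !subrK.
Qed.

Lemma to_loc_is_monoid_morphism : monoid_morphism to_loc.
Proof.
split=> [|x y]; first by rewrite loc1.
by rewrite locM; congr (\pi_T _); apply: Localization.eq_frac; rewrite /= ?mulr1.
Qed.

HB.instance Definition _ := GRing.isZmodMorphism.Build R T to_loc to_loc_is_zmod_morphism.
HB.instance Definition _ := GRing.isMonoidMorphism.Build R T to_loc to_loc_is_monoid_morphism.

Lemma to_loc_eq0P r : to_loc r = 0 <-> exists2 u, u \notin P & u * r = 0.
Proof.
rewrite -(rmorph0 to_loc); split=> [/eqmodP/Localization.equivlP[u]|[u uP ur]].
  by rewrite /= !mulr1 mulr0 => ur; exists (val u) => //; exact: (valP u).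
by apply/eqmodP/Localization.equivlP; exists (Sub u uP); rewrite /= !mulr1 mulr0.
Qed.

Lemma to_loc_unit s : s \notin P -> exists y, y * to_loc s = 1.
Proof.
move=> sP; exists (\pi_T (1, Sub s sP)); rewrite locM loc1.
apply/eqmodP/Localization.equivlP; exists (Localization.denom1 P).
by rewrite /= !mul1r !mulr1.
Qed.

Lemma loc_num (y : T) : exists r s, s \notin P /\ to_loc s * y = to_loc r.
Proof.
elim/quotW: y => -[r s]; exists r, (val s); split; first exact: (valP s).
rewrite locM; apply/eqmodP/Localization.equivlP; exists (Localization.denom1 P).
by rewrite /= !mul1r !mulr1 mulrC.
Qed.

Lemma loc_frac (y : T) : exists r w s, [/\ s \notin P, w * to_loc s = 1 & y = w * to_loc r].
Proof.
have [r [s [sP e]]] := loc_num y; have [w ws] := to_loc_unit sP.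
by exists r, w, s; split=> //; rewrite -e mulrA ws mul1r.
Qed.

Lemma to_loc_nonunit r : r \in P -> nonunit (to_loc r).
Proof.
move=> rP [y]; have [a [s [sP e]]] := loc_num y => yr.
have /to_loc_eq0P[u uP] : to_loc (a * r - s) = 0.
  by rewrite rmorphB rmorphM /= -e -mulrA yr mulr1 subrr.
rewrite mulrBr => /eqP; rewrite subr_eq0 => /eqP us.
have : u * s \in P by rewrite -us !idealMr.
by rewrite prime_idealrM (negPf uP) (negPf sP).
Qed.

Lemma nonunit_num (y : T) s r : nonunit y -> s \notin P -> to_loc s * y = to_loc r -> r \in P.
Proof.
move=> ny sP e; apply: contrapT => /negP/to_loc_unit[z zr].
by apply: ny; exists (z * to_loc s); rewrite -mulrA e.
Qed.

(** For [c = r / s] the numerators [r] and [s - r] cannot both lie in [P], as their sum [s] does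
    not. *)
Lemma loc_unit_or (c : T) : (exists y, y * c = 1) \/ (exists y, y * (1 - c) = 1).
Proof.
have [r [s [sP e]]] := loc_num c.
case: (boolP (r \in P)) => rP; last first.
  by left; have [y yr] := to_loc_unit rP; exists (y * to_loc s); rewrite -mulrA e.
right; have [|y ysr] := @to_loc_unit (s - r).
  by apply: contraNN sP => srP; rewrite -(subrK r s) rpredD.
by exists (y * to_loc s); rewrite -mulrA mulrBr mulr1 e -rmorphB.
Qed.

Lemma dim_le2_loc : dim_le2 R -> dim_le2 T.
Proof.
move=> dimR a b c.
have [a' [ua [sa [_ ea ->]]]] := loc_frac a; have [b' [ub [sb [_ eb ->]]]] := loc_frac b.
have [c' [uc [sc [_ ec ->]]]] := loc_frac c.
have [i [j [k [x [y [z]]]]]] := dimR a' b' c'.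
move=> /(congr1 to_loc); rewrite !(rmorphM, rmorphD, rmorphXn, rmorph1, rmorph0) /= => h.
(* These witnesses make the new relation the one between the numerators, multiplied by
   [ua ^+ i * ub ^+ j * uc ^+ k]. *)
exists i, j, k, (uc ^+ k * ub ^+ j * to_loc sa * to_loc x), (uc ^+ k * to_loc sb * to_loc y),
  (to_loc sc * to_loc z).
set A := to_loc a' in h *; set B := to_loc b' in h *; set C := to_loc c' in h *.
rewrite !exprMn.
have -> : uc * C * (to_loc sc * to_loc z) = C * to_loc z * (uc * to_loc sc) by ring.
have -> : ub * B * (uc ^+ k * to_loc sb * to_loc y) =
  uc ^+ k * B * to_loc y * (ub * to_loc sb) by ring.
have -> : ua * A * (uc ^+ k * ub ^+ j * to_loc sa * to_loc x) =
  uc ^+ k * ub ^+ j * A * to_loc x * (ua * to_loc sa) by ring.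
rewrite ea eb ec !mulr1.
transitivity (ua ^+ i * ub ^+ j * uc ^+ k * 0); last by rewrite mulr0.
by rewrite -h; ring.
Qed.

Lemma loc_prime (Q : prime_idealr R) : {subset Q <= P} ->
  exists Q' : prime_idealr T, forall r, (to_loc r \in Q') = (r \in Q).
Proof.
move=> QP.
pose E (y : T) := exists r s, [/\ r \in Q, s \notin P & to_loc s * y = to_loc r].
have QnP s : s \notin P -> s \notin Q by apply: contraNN; apply: QP.
(* Whether the numerator lies in [Q] does not depend on the fraction chosen for [y]. *)
have Enum y r s : s \notin P -> to_loc s * y = to_loc r -> E y <-> r \in Q.
  move=> sP e; split=> [[r' [s' [r'Q s'P e']]]|rQ]; last by exists r, s.
  have /to_loc_eq0P[u uP] : to_loc (s' * r - s * r') = 0.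
    by rewrite rmorphB !rmorphM /= -e -e'; ring.
  rewrite mulrBr => /eqP; rewrite subr_eq0 => /eqP us.
  have : u * (s' * r) \in Q by rewrite us !idealMr.
  by rewrite !prime_idealrM (negPf (QnP _ uP)) (negPf (QnP _ s'P)).
have Eto r : E (to_loc r) <-> r \in Q.
  by apply: (@Enum _ r 1); rewrite ?idealr1 // rmorph1 mul1r.
have [||Q' Q'E] := @prime_idealr_of T [pred y | `[< E y >]].
- split; first by apply/asboolP; rewrite -(rmorph0 to_loc) Eto idealr0.
    by apply/asboolP; rewrite -(rmorph1 to_loc) Eto idealr1.
  move=> a u v /asboolP[r [s [rQ sP er]]] /asboolP[t [w [tQ wP et]]].
  have [a' [b [bP ea]]] := loc_num a.
  apply/asboolP; exists (w * a' * r + b * s * t), (b * s * w).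
  split; first by rewrite rpredD // idealMr.
    by rewrite !prime_idealrM !negb_or bP sP.
  by rewrite rmorphD !rmorphM /= -ea -er -et; ring.
- move=> u v /asboolP Euv.
  have [r [s [sP er]]] := loc_num u; have [t [w [wP et]]] := loc_num v.
  have : r * t \in Q.
    apply/(@Enum (u * v) (r * t) (s * w)) => //; first by rewrite prime_idealrM negb_or sP.
    by rewrite !rmorphM /= -er -et; ring.
  rewrite prime_idealrM => /orP[rQ|tQ]; apply/orP; [left|right]; apply/asboolP.
    by exists r, s.
  by exists t, w.
by exists Q' => r; rewrite Q'E; apply/asboolP/idP => /Eto.
Qed.

Lemma loc_chain2 (P0 P1 P2 : prime_idealr R) a b :
    {subset P0 <= P1} -> {subset P1 <= P2} -> {subset P2 <= P} ->
    a \in P1 -> a \notin P0 -> b \in P2 -> b \notin P1 ->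
  @prime_chain T 2.
Proof.
move=> P01 P12 P2P a1 a0 b2 b1.
have P1P x : x \in P1 -> x \in P by move/P12/P2P.
have P0P x : x \in P0 -> x \in P by move/P01/P1P.
have [Q0 e0] := loc_prime P0P; have [Q1 e1] := loc_prime P1P; have [Q2 e2] := loc_prime P2P.
have sub (A B : prime_idealr R) (A' B' : prime_idealr T) :
    (forall r, (to_loc r \in A') = (r \in A)) -> (forall r, (to_loc r \in B') = (r \in B)) ->
    {subset A <= B} -> {subset A' <= B'}.
  move=> eA eB AB y; have [r [u [s [sP us ->]]]] := loc_frac y => yA.
  rewrite idealMr // eB AB // -eA.
  by rewrite -[to_loc r]mul1r -us (mulrC u) -mulrA idealMr.
exists (fun i => if i is i'.+1 then if i' is _.+1 then Q2 else Q1 else Q0).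
case=> [|[|//]] _; split; [exact: (sub P0 P1)| |exact: (sub P1 P2)|] => h.
  by move: a0; rewrite -e0 h ?e1.
by move: b1; rewrite -e1 h ?e2.
Qed.

(** Dimension and depth are both 2: [dim_le2] bounds them from above, while [a] and [b] yield a
    chain of primes and remain a regular sequence after localizing. *)
Lemma local_cohen_macaulay_dim2 a b : dim_le2 R -> a \in P -> b \in P ->
    (forall x, a * x = 0 -> x = 0) -> (forall x y, b * x = a * y -> exists z, x = a * z) ->
  local_cohen_macaulay T.
Proof.
move=> dimR aP bP rega regb; have dimT := dim_le2_loc dimR.
exists 2%N; split; [|by move=> e; apply: dim_le2_chain| |
  by move=> s [_ /dim_le2_regular_seq]; apply].
(* The factor [s] outside [P] in the avoided set forces [P1] into [P]; the same device below puts
   [P0] inside [P1]. *)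
- have [|||||P1 [P1a P1b]] := @prime_avoiding R (fun x => exists z, x = a * z)
      (fun x => exists n s, s \notin P /\ x = b ^+ n * s).
  + by exists 0; rewrite mulr0.
  + by move=> c _ _ [u ->] [v ->]; exists (c * u + v); ring.
  + by exists 0%N, 1; rewrite idealr1 mul1r.
  + move=> _ _ [n [s [sP ->]]] [m [t [tP ->]]]; exists (n + m)%N, (s * t).
    by rewrite prime_idealrM negb_or sP tP exprD; split=> //; ring.
  (* If [b ^+ n * s] is a multiple of [a], cancelling [b] modulo [a] repeatedly makes [s] a multiple
     of [a], hence an element of [P]. *)
  + move=> x [z ->] [n [s [sP]]]; elim: n z => [|n IH] z.
      by rewrite mul1r => az; move: sP; rewrite -az mulrC idealMr.
    by rewrite exprS -mulrA => /esym/regb[w]; move/esym; apply: IH.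
  have [|||||P0 [_ P0a]] := @prime_avoiding R (fun x => x = 0)
      (fun x => exists n s, s \notin P1 /\ x = a ^+ n * s).
  + by [].
  + by move=> c _ _ -> ->; rewrite mulr0 addr0.
  + by exists 0%N, 1; rewrite idealr1 mul1r.
  + move=> _ _ [n [s [sP ->]]] [m [t [tP ->]]]; exists (n + m)%N, (s * t).
    by rewrite prime_idealrM negb_or sP tP exprD; split=> //; ring.
  + move=> _ -> [n [s [sP]]]; elim: n => [|n IH].
      by rewrite mul1r => s0; move: sP; rewrite -s0 idealr0.
    by rewrite exprS -mulrA => /esym/rega/esym.
  apply: (@loc_chain2 P0 P1 P a b) => //.
  + move=> x; apply: contraTT => xP1; apply: P0a; exists 0%N, x.
    by rewrite mul1r.
  + move=> x; apply: contraTT => xP; apply: P1b; exists 0%N, x.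
    by rewrite mul1r.
  + by apply: P1a; exists 1; rewrite mulr1.
  + by apply: P0a; exists 1%N, 1; rewrite idealr1 mulr1.
  + by apply: P1b; exists 1%N, 1; rewrite idealr1 mulr1.
exists [:: to_loc a; to_loc b] => //; split.
  by move=> x; rewrite !inE => /orP[]/eqP->; apply: to_loc_nonunit.
split; last first.
  apply/gen_ideal2P => -[c [e h]].
  have [r [s [sP er]]] := loc_num c; have [t [w [wP et]]] := loc_num e.
  apply: (@to_loc_nonunit (r * w * a + t * s * b)); first by rewrite rpredD // idealMr.
  have [|y ysw] := @to_loc_unit (s * w); first by rewrite prime_idealrM negb_or sP.
  exists y; rewrite -ysw; congr (y * _); rewrite -[RHS]mulr1 h.
  by rewrite rmorphD !rmorphM /= -er -et; ring.
case=> [|[|//]] _ y; have [r [u [s [sP us ->]]]] := loc_frac y => /=.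
  rewrite !gen_ideal_nilP => /eqP/(congr1 ( *%R (to_loc s))).
  rewrite mulr0.
  have -> : to_loc s * (to_loc a * (u * to_loc r)) = (u * to_loc s) * (to_loc a * to_loc r) by ring.
  rewrite us mul1r -rmorphM => /to_loc_eq0P[v vP].
  rewrite mulrCA => /rega vr; suff -> : to_loc r = 0 by rewrite mulr0.
  by apply/to_loc_eq0P; exists v.
case/gen_ideal1P=> c hc; have [t [w [v [vP wv ec]]]] := loc_frac c.
have /to_loc_eq0P[p pP] : to_loc (v * (b * r) - s * (t * a)) = 0.
  rewrite rmorphB !rmorphM.
  have -> : to_loc v * (to_loc b * to_loc r) =
      to_loc v * to_loc s * (to_loc b * (u * to_loc r)).
    transitivity (to_loc v * (to_loc b * to_loc r) * (u * to_loc s)); last by ring.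
    by rewrite us mulr1.
  rewrite hc ec.
  have -> : to_loc v * to_loc s * (w * to_loc t * to_loc a) =
     (w * to_loc v) * (to_loc s * (to_loc t * to_loc a)) by ring.
  by rewrite wv mul1r subrr.
rewrite mulrBr => /eqP; rewrite subr_eq0 => /eqP e.
(* Clearing denominators has turned the relation in the localization into one in [R]; [p] is the
   factor that kills the difference. *)
have [|z ez] := @regb (p * v * r) (p * s * t).
  transitivity (p * (v * (b * r))); first by ring.
  by rewrite e; ring.
have [|q qpv] := @to_loc_unit (p * v); first by rewrite prime_idealrM negb_or pP.
apply/gen_ideal1P; exists (u * q * to_loc z).
have -> : u * to_loc r = u * (q * to_loc (p * v)) * to_loc r by rewrite qpv mulr1.
have -> : u * (q * to_loc (p * v)) * to_loc r = u * q * to_loc (p * v * r).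
  by rewrite !rmorphM; ring.
by rewrite ez rmorphM; ring.
Qed.

End LocalRing.

(** * Noetherian rings *)

Section Noetherian.

(** Arbitrary predicates are allowed and the unit ideal is included, so unions and preimages of
    ideals need no check of properness. *)
Definition fg_ideals (A : comNzRingType) := forall I : A -> Prop,
  I 0 -> (forall a u v, I u -> I v -> I (a * u + v)) ->
  exists s, forall x, I x <-> x \in gen_ideal s.

Lemma gen_ideal_sub (A : comNzRingType) (s t : seq A) :
  {subset s <= gen_ideal t} -> {subset gen_ideal s <= gen_ideal t}.
Proof. by apply: gen_ideal_min => [|a u v]; [exact: gen_ideal0|exact: gen_idealD]. Qed.

Lemma gen_mkseqS (A : comNzRingType) (a : nat -> A) m n : (m <= n)%N ->
  {subset gen_ideal (mkseq a m) <= gen_ideal (mkseq a n)}.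
Proof.
move=> mn; apply: gen_ideal_sub => x /mapP[i]; rewrite mem_iota => /andP[_ im] ->.
by apply/gen_ideal_mem/map_f; rewrite mem_iota (leq_trans im).
Qed.

(** The union of the ideals of the initial segments is finitely generated, so one of them already
    contains every term. *)
Lemma fg_ideals_seq (A : comNzRingType) (a : nat -> A) : fg_ideals A ->
  exists N, a N \in gen_ideal (mkseq a N).
Proof.
move=> fgA; have [||s sP] := fgA (fun x => exists k, x \in gen_ideal (mkseq a k)).
- by exists 0%N; apply: gen_ideal0.
- move=> c u v [k ku] [l lv]; exists (maxn k l); apply: gen_idealD.
    by apply: gen_mkseqS ku; rewrite leq_maxl.
  by apply: gen_mkseqS lv; rewrite leq_maxr.
have [N sN] : exists N, {subset s <= gen_ideal (mkseq a N)}.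
  have : forall x, x \in s -> exists k, x \in gen_ideal (mkseq a k).
    by move=> x xs; apply/sP; apply: gen_ideal_mem.
  elim: (s) => [|x t IH] h; first by exists 0%N.
  have [|M tM] := IH; first by move=> y yt; apply: h; rewrite inE yt orbT.
  have [|k xk] := h x; first by rewrite mem_head.
  exists (maxn k M) => y; rewrite inE => /predU1P[->|/tM].
    by apply: gen_mkseqS xk; rewrite leq_maxl.
  by apply: gen_mkseqS; rewrite leq_maxr.
exists N; apply: gen_ideal_sub sN _ _; apply/sP; exists N.+1.
by apply/gen_ideal_mem/map_f; rewrite mem_iota /= add0n.
Qed.

(** Otherwise choose [f k] of least size in [I] outside the ideal of the earlier ones. Some leading
    coefficient is a combination of the previous ones; subtracting the matching combination [h]
    contradicts minimality. *)
Lemma hilbert_basis (A : comNzRingType) : fg_ideals A -> fg_ideals {poly A}.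
Proof.
move=> fgA I I0 ID; apply: contrapT => nfg.
have Igen s : (forall x, x \in s -> I x) -> forall x, x \in gen_ideal s -> I x.
  by move=> Is; apply: (gen_ideal_min I0 ID).
(* For a list not contained in [I] nothing is asked, and 0 serves as the witness. *)
have /boolp.choice[F FP] (s : seq {poly A}) : exists f, (forall x, x \in s -> I x) ->
    [/\ I f, f \notin gen_ideal s &
        forall g, I g -> g \notin gen_ideal s -> (size f <= size g)%N].
  case: (EM (forall x, x \in s -> I x)) => [Is|nIs]; last by exists 0.
  pose bad k := `[< exists f : {poly A}, [/\ I f, f \notin gen_ideal s & size f = k] >].
  have exbad : exists k, bad k.
    apply: contrapT => nb; apply: nfg; exists s => x; split=> [Ix|]; last exact: Igen.
    by apply: contrapT => /negP xs; apply: nb; exists (size x); apply/asboolP; exists x.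
  case: (ex_minnP exbad) => k /asboolP[f [If fs fk]] mink; exists f => _; split=> //.
  by move=> g Ig gs; rewrite fk; apply/mink/asboolP; exists g.
pose L k := iter k (fun s => rcons s (F s)) [::].
pose f k := F (L k).
have LE k : L k = mkseq f k.
  by elim: k => // k IH; rewrite /mkseq -[k.+1]addn1 iotaD map_cat addn1 cats1 -[map _ _]IH.
have IL k x : x \in L k -> I x.
  elim: k x => // k IH x; rewrite mem_rcons inE => /predU1P[->|]; last exact: IH.
  by have [] := FP _ IH.
have If k : I (f k) by have [] := FP _ (IL k).
have fL k : f k \notin gen_ideal (mkseq f k) by rewrite -LE; have [] := FP _ (IL k).
have minf k g : I g -> g \notin gen_ideal (mkseq f k) -> (size (f k) <= size g)%N.
  by move=> Ig; rewrite -LE; have [_ _] := FP _ (IL k); apply.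
have f0 k : f k != 0 by apply: contraNneq (fL k) => ->; apply: gen_ideal0.
have [N /gen_idealP[c]] := fg_ideals_seq (fun k => lead_coef (f k)) fgA.
rewrite size_mkseq => aN.
have szf (i : 'I_N) : (size (f i) <= size (f N))%N.
  by apply: minf => //; apply: contraNN (fL N); apply: gen_mkseqS; apply: ltnW.
pose h := \sum_(i < N) c i *: (f i * 'X^(size (f N) - size (f i))).
have hL : h \in gen_ideal (mkseq f N).
  rewrite /h; elim/big_ind: _ => [|u v uL vL|i _]; first exact: gen_ideal0.
    by rewrite -[u]mul1r; apply: gen_idealD.
  rewrite -mul_polyC mulrCA mulrC -[_ * _]addr0; apply: gen_idealD (gen_ideal0 _).
  by apply/gen_ideal_mem/map_f; rewrite mem_iota /=.
have Ih : I h by apply: Igen hL => x; rewrite -LE; apply: IL.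
have Ifh : I (f N - h) by rewrite addrC -mulN1r; apply: ID.
have fhL : f N - h \notin gen_ideal (mkseq f N).
  apply: contraNN (fL N) => fhL.
  by rewrite -(subrK h (f N)) -[_ - _]mul1r; apply: gen_idealD.
have := minf N _ Ifh fhL; apply/negP; rewrite -ltnNge.
have sN : (0 < size (f N))%N by rewrite size_poly_gt0.
have szh : (size h <= size (f N))%N.
  apply/(leq_trans (size_sum _ _ _))/bigmax_leqP => i _.
  apply: leq_trans (size_scale_leq _ _) _.
  by rewrite size_mulXn // subnK.
rewrite -(prednK sN) ltnS; apply/leq_sizeP => j; rewrite leq_eqVlt => /predU1P[<-|jN].
  rewrite coefB coef_sum -lead_coefE aN; apply/eqP; rewrite subr_eq0; apply/eqP.
  apply: eq_bigr => i _; rewrite nth_mkseq // coefZ coefMXn.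
  have si : (0 < size (f i))%N by rewrite size_poly_gt0.
  have -> : ((size (f N)).-1 < size (f N) - size (f i))%N = false.
    by have := szf i; lia.
  congr (_ * _); rewrite lead_coefE; congr (_`_ _).
  by rewrite -!subn1 subnAC subKn.
move: jN; rewrite (prednK sN) => jN.
by rewrite coefB !nth_default ?subr0 // (leq_trans szh).
Qed.

Lemma fg_ideals_field (K : fieldType) : fg_ideals K.
Proof.
move=> I I0 ID; case: (EM (exists2 x, I x & x != 0)) => [[x Ix x0]|nx].
  exists [:: 1] => y; split=> [_|_]; first by apply/gen_ideal1P; exists y; rewrite mulr1.
  by rewrite -(divfK x0 y) -[_ * x]addr0; apply: ID.
exists [::] => y; rewrite gen_ideal_nilP; split=> [Iy|/eqP->] //.
by apply: contrapT => /negP y0; apply: nx; exists y.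
Qed.

Lemma fg_ideals_surj (B R : comNzRingType) (f : {rmorphism B -> R}) :
  (forall y, exists x, f x = y) -> fg_ideals B -> noetherian R.
Proof.
move=> fsurj fgB I [I0 _ ID].
have [||s sP] := fgB (fun x => f x \in I); first by rewrite rmorph0.
  by move=> a u v; rewrite rmorphD rmorphM; apply: ID.
exists (map f s) => y; have [x <-] := fsurj y.
have gen z : z \in gen_ideal s -> f z \in gen_ideal (map f s).
  move: z; apply: (@gen_ideal_min _ (fun z => f z \in gen_ideal (map f s))) => [|a u v|z zs].
      by rewrite rmorph0 gen_ideal0.
    by rewrite rmorphD rmorphM; apply: gen_idealD.
  exact/gen_ideal_mem/map_f.
apply/idP/idP => [/sP/gen //|].
apply: (@gen_ideal_min _ (fun y => y \in I)) => [//|a u v|_ /mapP[z zs ->]]; first exact: ID.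
exact/sP/gen_ideal_mem.
Qed.

(** [B] is an iterated univariate polynomial ring over [K], with one variable for each element of
    [xs]. *)
Lemma fg_ideals_cover (K : fieldType) (R : comNzRingType) (k : {rmorphism K -> R}) (xs : seq R) :
  exists (B : comNzRingType) (f : {rmorphism B -> R}), [/\ fg_ideals B,
    forall c, exists b, f b = k c & forall x, x \in xs -> exists b, f b = x].
Proof.
elim: xs => [|x xs [B [f [fgB fk fxs]]]].
  by exists K, k; split=> // [|c]; [exact: fg_ideals_field|exists c].
have cfx : commr_rmorph f x by move=> b; apply: mulrC.
exists {poly B}, (horner_morph cfx); split; first exact: hilbert_basis.
  by move=> c; have [b <-] := fk c; exists b%:P; rewrite /= horner_morphC.
move=> y; rewrite inE => /predU1P[->|/fxs[b <-]].
  by exists 'X; rewrite /= horner_morphX.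
by exists b%:P; rewrite /= horner_morphC.
Qed.

Lemma noetherian_mpoly_surj (K : fieldType) n (R : comNzRingType)
    (h : {rmorphism {mpoly K[n]} -> R}) : (forall y, exists p, h p = y) -> noetherian R.
Proof.
move=> hsurj.
have [B [f [fgB fk fX]]] := fg_ideals_cover (h \o @mpolyC n K) [seq h 'X_i | i : 'I_n].
apply: (@fg_ideals_surj B R f) fgB => y; have [p <-] := hsurj y; rewrite [p]mpolyE.
elim: (msupp p) => [|m ms [b IH]]; first by exists 0; rewrite big_nil !rmorph0.
have [c fc] := fk p@_m.
have /choice[e fe] (i : 'I_n) : exists b, f b = h 'X_i by apply: fX; apply: map_f; rewrite mem_enum.
exists (c * \prod_i e i ^+ m i + b); rewrite big_cons !rmorphD IH; congr (_ + _).
rewrite -mul_mpolyC !rmorphM /= fc mpolyXE_id !rmorph_prod; congr (_ * _).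
by apply: eq_bigr => i _; rewrite !rmorphXn /= fe.
Qed.

End Noetherian.

(** * Integral elements *)

Section Algebraicity.

(** Multiplying a monic equation of degree [n + 1] for [z] by [f e ^+ n] leaves [z] plus a
    polynomial in [f e]. *)
Lemma integral_inv_image (A L : comNzRingType) (f : {rmorphism A -> L}) e z :
  integralOver f z -> z * f e = 1 -> exists g, z = f g.
Proof.
move=> [p mon_p /rootP pz] ze.
have sp : (0 < size p)%N by rewrite size_poly_gt0 monic_neq0.
have pz' : \sum_(i < (size p).-1.+1) f p`_i * z ^+ i = 0.
  rewrite prednK // -[RHS]pz (@horner_coef_wide _ (size p)) ?size_poly //.
  by apply: eq_bigr => i _; rewrite coef_map.
move: pz'; rewrite big_ord_recr /= -lead_coefE (monicP mon_p) rmorph1 mul1r.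
(* A monic equation of degree 0 would read 1 = 0. *)
case: (_.-1) => [|n]; first by rewrite big_ord0 add0r => /eqP; rewrite oner_eq0.
move/(congr1 ( *%R^~ (f e ^+ n))); rewrite mul0r mulrDl exprS -mulrA -exprMn ze expr1n mulr1.
move/eqP; rewrite addrC addr_eq0 => /eqP->.
exists (- \sum_(i < n.+1) p`_i * e ^+ (n - i)); rewrite rmorphN rmorph_sum mulr_suml.
congr (- _); apply: eq_bigr => i _; rewrite rmorphM rmorphXn -mulrA.
have ni : (i <= n)%N by rewrite -ltnS.
have -> : f e ^+ n = f e ^+ i * f e ^+ (n - i) by rewrite -exprD subnKC.
by rewrite (mulrA (z ^+ i)) -exprMn ze expr1n mul1r.
Qed.

(* Zariski's lemma for a field that is integral over K[a, b]: were a
   transcendental, then b would be integral over some K[a, 1/c], and so would be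
   the inverse of 1 + a c, which is absurd. *)
Lemma algebraic_of_integral (K : fieldType) (L : comNzRingType) (k : {rmorphism K -> L}) (a b : L) :
    (forall y : L, y != 0 -> exists z, z * y = 1) ->
    (forall (A : comNzRingType) (f : {rmorphism A -> L}),
      (forall c, integralOver f (k c)) -> integralOver f a -> integralOver f b ->
      forall y, integralOver f y) ->
  exists2 p : {poly K}, p != 0 & (map_poly k p).[a] = 0.
Proof.
move=> fieldL intL; apply: contrapT => nalg.
have cka : commr_rmorph k a by move=> ?; apply: mulrC.
pose E1 : {rmorphism {poly K} -> L} := horner_morph cka.
have E1_inj p : E1 p = 0 -> p = 0.
  by move=> p0; apply: contrapT => /eqP pn0; apply: nalg; exists p.
have E1a : E1 'X = a by rewrite /= horner_morphX.
have E1k c : E1 c%:P = k c by rewrite /= horner_morphC.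
pose E2 x : {rmorphism {poly {poly K}} -> L} :=
  horner_morph (fun c : {poly K} => mulrC x (E1 c)).
have E2X x : E2 x 'X = x by rewrite /= horner_morphX.
have E2C x c : E2 x c%:P = E1 c by rewrite /= horner_morphC.
have int2 x : integralOver (E2 x) b -> forall y, integralOver (E2 x) y.
  apply: intL => [c|]; first by rewrite -E1k -(E2C x); apply: integral_id.
  by rewrite -E1a -(E2C x); apply: integral_id.
have [z za] : exists z, z * a = 1.
  apply: fieldL; apply/eqP => a0; have := @E1_inj 'X.
  by rewrite E1a => /(_ a0)/eqP; rewrite polyX_eq0.
have [G zG] : exists G, z = E2 b G.
  apply: (@integral_inv_image _ _ _ 'X%:P); last by rewrite E2C E1a.
  by apply: int2; rewrite -[X in integralOver _ X]E2X; apply: integral_id.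
(* A relation for [b] over K[a], obtained by writing the inverse of [a] as [G] at [b]; it is nonzero
   because setting both variables to 0 gives 1. *)
pose F := 1 - 'X%:P * G.
have F0 : F != 0.
  rewrite subr_eq0; apply/eqP => /(congr1 (fun p : {poly {poly K}} => (p`_0).[0])).
  by rewrite /= coefCM coef1 hornerM hornerX mul0r hornerE => /eqP; rewrite oner_eq0.
have E2F : E2 b F = 0 by rewrite rmorphB rmorph1 rmorphM E2C E1a -zG mulrC za subrr.
pose c := lead_coef F.
have [w wc] : exists w, w * E1 c = 1.
  by apply/fieldL/eqP => /E1_inj/eqP; rewrite lead_coef_eq0 (negPf F0).
(* Once the inverse [w] of the leading coefficient of [F] is adjoined, [F] scales to a monic
   equation for [b]. *)
have intw : forall y, integralOver (E2 w) y.
  apply: int2; pose q := w *: map_poly E1 F.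
  have qF : q`_(size F).-1 = 1 by rewrite coefZ coef_map -lead_coefE.
  have szq : size q = size F.
    apply/eqP; rewrite eqn_leq (leq_trans (size_scale_leq _ _)) ?size_poly //=.
    have sF : (0 < size F)%N by rewrite size_poly_gt0.
    by rewrite -(prednK sF) ltnNge; apply/negP => /leq_sizeP/(_ _ (leqnn _))/eqP; rewrite qF oner_eq0.
  apply: (@integral_root_monic _ _ _ _ q).
  - by rewrite monicE lead_coefE szq qF.
  - apply/rootP; rewrite hornerZ; suff -> : (map_poly E1 F).[b] = 0 by rewrite mulr0.
    exact: E2F.
  - apply/integral_poly => i; rewrite coefZ coef_map; apply: integral_mul.
      by rewrite -[X in integralOver _ X]E2X; apply: integral_id.
    rewrite -[X in integralOver _ X](E2C w); exact: integral_id.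
(* [e] is nonconstant and coprime to [c]; its inverse, if in K[a, w], would make it divide a power
   of [c]. *)
pose e := 1 + 'X * c.
have c0 : c != 0 by rewrite lead_coef_eq0.
have sze : size e = (size c).+1.
  by rewrite /e addrC mulrC size_polyDl ?size_mulX ?size_poly1 // ltnS size_poly_gt0.
have [z' ze'] : exists z', z' * E1 e = 1.
  by apply/fieldL/eqP => /E1_inj/eqP; rewrite -size_poly_eq0 sze.
have [G' zG'] := integral_inv_image (intw z') (etrans (congr1 ( *%R z') (E2C w e)) ze').
have [N [g cg]] : exists N g, E1 c ^+ N * E2 w G' = E1 g.
  elim/poly_ind: (G') => [|p d [N [g Ng]]]; first by exists 0%N, 0; rewrite !rmorph0 mulr0.
  exists N.+1, (g + c ^+ N.+1 * d).
  rewrite !rmorphD !rmorphM E2X E2C rmorphXn /= -/(E1 c) -/(E1 g) -/(E1 d) -Ng.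
  rewrite exprS mulrDr; congr (_ + _).
  transitivity (E1 c ^+ N * E2 w p * (w * E1 c)); first by rewrite /=; ring.
  by rewrite wc mulr1.
have cNe : c ^+ N = g * e.
  apply/eqP; rewrite -subr_eq0; apply/eqP/E1_inj.
  by rewrite rmorphB rmorphM rmorphXn -cg -zG' -mulrA ze' mulr1 subrr.
have : coprimep e (c ^+ N).
  apply/coprimep_expr/Bezout_eq1_coprimepP; exists (1, - 'X) => /=.
  by rewrite /e; ring.
rewrite coprimep_def => /eqP; have : e %| c ^+ N by rewrite cNe dvdp_mull.
move=> /dvdp_gcd_idl/eqp_size -> /eqP; rewrite sze eqSS size_poly_eq0.
by rewrite (negPf c0).
Qed.

End Algebraicity.

(** * Stanley-Reisner rings *)

(* Up to units b a1 = a b1, so regularity gives a1 = c (a1 + a2) for some c, and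
   either c or 1 - c is a unit. *)
Lemma orthogonal_regular_pair (T : comNzRingType) (a b r t a1 a2 b1 b2 : T) :
    (forall c : T, (exists y, y * c = 1) \/ (exists y, y * (1 - c) = 1)) ->
    (exists y, y * r = 1) -> (exists y, y * t = 1) ->
    r * a = a1 + a2 -> t * b = b1 + b2 -> a1 * b2 = 0 -> b1 * a2 = 0 ->
    (forall y z, b * y = a * z -> exists w, y = w * a) ->
  (exists e, a2 = e * a1) \/ (exists e, a1 = e * a2).
Proof.
move=> localT [y yr] [z zt] ra tb a1b2 b1a2 regb.
have [w wa] : exists w, t * a1 = w * a.
  apply: (regb _ (r * b1)).
  transitivity ((t * b) * a1); first by ring.
  transitivity ((r * a) * b1); last by ring.
  rewrite tb ra; transitivity (b1 * a1 + a1 * b2); first by ring.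
  by rewrite a1b2 -b1a2; ring.
pose c := z * w * y.
have a1E : a1 = c * (a1 + a2).
  rewrite -ra; transitivity (z * w * a * (y * r)); last by rewrite /c; ring.
  by rewrite yr mulr1 -(mulrA z) -wa mulrA zt mul1r.
have ca2 : c * a2 = (1 - c) * a1 by rewrite mulrBl mul1r {1}a1E; ring.
have [[e ec]|[e ec]] := localT c; [left|right].
  by exists (e * (1 - c)); rewrite -mulrA -ca2 mulrA ec mul1r.
by exists (e * c); rewrite -mulrA ca2 mulrA ec mul1r.
Qed.

(** * Restriction of polynomials to the variables of a face *)

Section Projection.
Variables (K : fieldType) (V : finType).
Local Notation S := {mpoly K[#|V|]}.
Implicit Types (p q : S) (m : 'X_{1..#|V|}) (F G : {set V}).

Definition msupport m : {set V} := [set v | m (enum_rank v) != 0%N].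

Definition proj F : S -> S :=
  mmap (@mpolyC #|V| K) (fun i : 'I_#|V| => if (enum_val i : V) \in F then 'X_i else 0 : S).

HB.instance Definition _ F := GRing.RMorphism.on (proj F).

Lemma proj_mon F m : proj F 'X_[m] = if msupport m \subset F then 'X_[m] else 0.
Proof.
rewrite /proj mmapX; case: ifPn => [mF|/subsetPn[v]].
  rewrite mpolyXE_id; apply: eq_bigr => i _; case: ifPn => // iF.
  have -> : m i = 0%N; last by rewrite !expr0.
  apply: contraNeq iF => mi; apply: (subsetP mF); by rewrite inE enum_valK.
rewrite inE => mv vF; rewrite /mmap1 (bigD1 (enum_rank v)) //=.
by rewrite enum_rankK (negPf vF) expr0n (negPf mv) mul0r.
Qed.

Lemma projZ F (c : K) p : proj F (c *: p) = c *: proj F p.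
Proof. by rewrite -mul_mpolyC rmorphM /= {1}/proj mmapC mul_mpolyC. Qed.

Lemma projC F (c : K) : proj F c%:MP = c%:MP.
Proof. exact: mmapC. Qed.

Lemma mcoeff_proj F p m : (proj F p)@_m = if msupport m \subset F then p@_m else 0.
Proof.
elim/mpolyind: p => [|c m' p _ _ IH]; first by rewrite rmorph0 mcoeff0 if_same.
rewrite rmorphD /= projZ proj_mon !mcoeffD IH !mcoeffZ mcoeffX.
have [<-|m'm] := eqVneq m' m.
  by case: ifP; rewrite ?mcoeffX ?eqxx ?mcoeff0 ?mulr0 ?addr0.
by case: ifP; case: ifP; rewrite ?mcoeffX ?(negPf m'm) ?mcoeff0 ?mulr0 ?add0r.
Qed.

Lemma proj_proj F G p : proj F (proj G p) = proj (F :&: G) p.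
Proof.
apply/mpolyP => m; rewrite !mcoeff_proj subsetI.
by case: (_ \subset F); case: (_ \subset G).
Qed.

Lemma proj_sub F G p : F \subset G -> proj F (proj G p) = proj F p.
Proof. by move=> /setIidPl FG; rewrite proj_proj FG. Qed.

Lemma proj_eq0_sub F G p : F \subset G -> proj G p = 0 -> proj F p = 0.
Proof. by move=> FG p0; rewrite -(proj_sub p FG) p0 rmorph0. Qed.

Lemma proj0 p : proj set0 p = (p@_0%MM)%:MP.
Proof.
apply/mpolyP => m; rewrite mcoeff_proj subset0 mcoeffC.
have [->|m0] := eqVneq m 0%MM.
  by rewrite mulr1; case: eqP => // /eqP/set0Pn[v]; rewrite inE mnm0E.
rewrite mulr0; case: eqP => // ms; case/eqP: m0; apply/mnmP => i.
have /setP/(_ (enum_val i)) := ms; rewrite !inE enum_valK mnm0E => /negbFE/eqP.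
exact.
Qed.

Definition mvar (v : V) : S := 'X_(enum_rank v).

Lemma msupport1 v : msupport U_(enum_rank v)%MM = [set v].
Proof.
by apply/setP => w; rewrite !inE mnm1E (inj_eq enum_rank_inj) [w == v]eq_sym; case: (v == w).
Qed.

Lemma proj_mvar F v : proj F (mvar v) = if v \in F then mvar v else 0.
Proof. by rewrite proj_mon msupport1 sub1set. Qed.

Lemma mvar_neq0 v : mvar v != 0.
Proof. by rewrite -msize_poly_eq0 mmeasureX. Qed.

Lemma proj_squarefree F G : proj F (squarefree_mon K G) =
  if G \subset F then squarefree_mon K G else 0.
Proof.
rewrite /squarefree_mon rmorph_prod; case: ifPn => [/subsetP GF|/subsetPn[v vG vF]].
  by apply: eq_bigr => v vG; have := proj_mvar F v; rewrite GF.
by rewrite (bigD1 v) //= [proj F _](proj_mvar F v) (negPf vF) mul0r.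
Qed.

Lemma squarefree_dvd m : exists q, 'X_[m] = q * squarefree_mon K (msupport m).
Proof.
pose e : 'X_{1..#|V|} := [multinom (enum_val i \in msupport m : nat) | i < #|V|].
have em : (e <= m)%MM.
  by apply/mnm_lepP => i; rewrite mnmE inE enum_valK; case: (m i).
exists 'X_[m - e]; rewrite -{1}(submK em) mpolyXD; congr (_ * _).
rewrite mpolyXE_id /squarefree_mon (reindex (enum_rank : V -> _)) /=; last first.
  by exists enum_val => ? _; rewrite ?enum_rankK ?enum_valK.
rewrite [RHS]big_mkcond; apply: eq_bigr => v _; rewrite mnmE enum_rankK.
by case: ifP; rewrite ?expr1 ?expr0.
Qed.

End Projection.

Section StanleyReisnerRing.
Variables (K : fieldType) (V : finType) (D : simplicial_complex V).
Local Notation S := {mpoly K[#|V|]}.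
Local Notation R := (SR_ring K D).
Implicit Types (p q : S) (F G : {set V}).

(** A polynomial that vanishes on all faces involves only monomials whose support is a nonface, and
    each is a multiple of the squarefree monomial of its support. *)
Lemma SR_idealP p : p \in SR_ideal D <-> forall F, F \in D -> proj F p = 0.
Proof.
split=> [pI F FD|p0].
  move: p pI; apply: gen_ideal_min => [|a u v u0 v0|x]; first exact: rmorph0.
    by rewrite rmorphD rmorphM /= u0 v0 mulr0 addr0.
  move=> /mapP[G]; rewrite mem_enum inE => GD ->; rewrite proj_squarefree.
  by case: ifP => // GF; rewrite (complex_down GF) in GD.
rewrite [p]mpolyE big_seq; elim/big_ind: _ => [|u v|m mp]; first exact: gen_ideal0.
  by move=> uI vI; rewrite -[u]mul1r; apply: gen_idealD.
have [q ->] := squarefree_dvd K m; rewrite scalerAl -[_ * _]addr0.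
apply: gen_idealD (gen_ideal0 _); apply: gen_ideal_mem; apply: map_f.
rewrite mem_enum inE; apply: contraTN mp => mD.
by have := congr1 (mcoeff m) (p0 _ mD); rewrite mcoeff_proj subxx mcoeff0 -mcoeff_eq0 => ->.
Qed.

Lemma sub_facet F : F \in D -> exists2 G, G \in facets D & F \subset G.
Proof.
move=> FD; have [G mG FG] := @maxset_exists _ [pred G | G \in faces D] F FD.
by exists G; rewrite ?inE.
Qed.

Lemma SR_ideal_facets p : (forall F, F \in facets D -> proj F p = 0) -> p \in SR_ideal D.
Proof.
move=> p0; apply/SR_idealP => F FD; have [G GD FG] := sub_facet FD.
exact: proj_eq0_sub FG (p0 _ GD).
Qed.

Definition sr_pi p : R := \pi_R p.

Lemma sr_pi_is_zmod_morphism : zmod_morphism sr_pi.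
Proof. by move=> p q; rewrite /sr_pi rmorphB. Qed.

Lemma sr_pi_is_monoid_morphism : monoid_morphism sr_pi.
Proof. by split=> [|p q]; rewrite /sr_pi ?rmorph1 ?rmorphM. Qed.

HB.instance Definition _ := GRing.isZmodMorphism.Build S R sr_pi sr_pi_is_zmod_morphism.
HB.instance Definition _ := GRing.isMonoidMorphism.Build S R sr_pi sr_pi_is_monoid_morphism.

Lemma sr_pi_surj (r : R) : exists p, sr_pi p = r.
Proof. by exists (repr r); rewrite /sr_pi reprK. Qed.

Lemma sr_pi_eq0 p : sr_pi p = 0 <-> forall F, F \in D -> proj F p = 0.
Proof.
rewrite -SR_idealP -(rmorph0 sr_pi); split=> [/eqP|pI].
  by rewrite /sr_pi -Quotient.idealrBE subr0.
by apply/eqP; rewrite /sr_pi -Quotient.idealrBE subr0.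
Qed.

(** [proj F] factors through [R], and its kernel is prime because it maps into a domain. *)
Lemma face_prime F : F \in D ->
  exists P : prime_idealr R, forall p, (sr_pi p \in P) = (proj F p == 0).
Proof.
move=> FD; pose Q : {pred R} := [pred r | proj F (repr r) == 0].
have QE p : (sr_pi p \in Q) = (proj F p == 0).
  have /sr_pi_eq0/(_ F FD) : sr_pi (p - repr (sr_pi p)) = 0.
    by rewrite rmorphB /= {2}/sr_pi reprK subrr.
  by rewrite rmorphB /= => /eqP; rewrite subr_eq0 inE => /eqP <-.
have [||P PQ] := @prime_idealr_of R Q; last by exists P => p; rewrite PQ QE.
- split; first by rewrite -(rmorph0 sr_pi) QE rmorph0.
    by rewrite -(rmorph1 sr_pi) QE rmorph1 oner_eq0.
  move=> a u v; have [p <-] := sr_pi_surj a; have [q <-] := sr_pi_surj u.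
  have [r <-] := sr_pi_surj v; rewrite !QE => /eqP q0 /eqP r0.
  by rewrite -rmorphM -rmorphD QE rmorphD rmorphM /= q0 r0 mulr0 addr0.
move=> u v; have [p <-] := sr_pi_surj u; have [q <-] := sr_pi_surj v.
by rewrite -rmorphM !QE rmorphM mulf_eq0.
Qed.

Lemma origin_maximal (P : prime_idealr R) :
  (forall p, (sr_pi p \in P) = (proj set0 p == 0)) -> maximal_ideal P.
Proof.
move=> PE; split; first split; [exact: idealr0|by rewrite idealr1|
  by move=> a u v uP vP; rewrite rpredD // idealMr|].
move=> I [I0 I1 ID] PI r; have [p <-] := sr_pi_surj r => pI.
rewrite PE proj0 mpolyC_eq0; apply: contraNT I1 => c0.
have mI : sr_pi (p - (p@_0%MM)%:MP) \in I.
  by apply: PI; rewrite PE rmorphB /= projC proj0 subrr.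
have cI : sr_pi (p@_0%MM)%:MP \in I.
  have -> : (p@_0%MM)%:MP = -1 * (p - (p@_0%MM)%:MP) + p by ring.
  by rewrite rmorphD rmorphM; apply: ID.
rewrite -(rmorph1 sr_pi) -mpolyC1 -(mulVf c0) mpolyCM rmorphM -[_ * _]addr0.
exact: ID.
Qed.

(** Connectedness of the graph of edges, stated through cuts instead of paths. *)
Definition cut_connected := forall A : {set V}, A != set0 -> A != setT ->
  exists u v, [/\ u \in A, v \notin A & [set u; v] \in D].

(* If no edge joins A to its complement, the maximal ideal at the origin is a sum
   I + J with I J = 0, I spanned by the variables in A and J by the others; a
   regular pair a, b would then have a killed by I or by J. *)
Lemma cohen_macaulay_connected : (exists2 F, F \in D & #|F| = 2%N) ->
  cohen_macaulay R -> cut_connected.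
Proof.
move=> [E ED E2] [_ CM] A A0 AT; apply: contrapT => ncut.
have [u [v [uv Euv]]] : exists u v, u != v /\ E = [set u; v].
  by have /eqP/cards2P[u [v [? ?]]] := E2; exists u, v.
have faceA F : F \in D -> F \subset A \/ F \subset ~: A.
  move=> FD; case: (boolP (F \subset A)) => [|/subsetPn[y yF yA]]; first by left.
  right; apply/subsetP => x xF; rewrite inE; apply/negP => xA; apply: ncut.
  by exists x, y; split=> //; apply: complex_down FD; rewrite subUset !sub1set xF.
have [P PE] := face_prime (complex_set0 D).
have [d [_ dmax] [[s ss [snu [sreg _]]] _]] := CM P (origin_maximal PE).
(* The depth equals the dimension, which is at least 2 by the primes of the edge [E], of its end [u]
   and of the origin. *)
have {dmax} s2 : (2 <= size s)%N.
  rewrite ss; apply: dmax.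
  have [P0 P0E] := face_prime ED; have [P1 P1E] := face_prime (complex_vertex D u).
  apply: (@loc_chain2 _ _ P0 P1 P (sr_pi (mvar K v)) (sr_pi (mvar K u))) => //.
  - move=> r; have [p <-] := sr_pi_surj r; rewrite P0E P1E => /eqP p0.
    by apply/eqP/(proj_eq0_sub _ p0); rewrite Euv sub1set !inE eqxx.
  - move=> r; have [p <-] := sr_pi_surj r; rewrite P1E PE => /eqP p0.
    by apply/eqP/(proj_eq0_sub _ p0)/sub0set.
  - by rewrite P1E proj_mvar inE [v == u]eq_sym (negPf uv).
  - by rewrite P0E proj_mvar Euv !inE eqxx orbT mvar_neq0.
  - by rewrite PE proj_mvar inE.
  - by rewrite P1E proj_mvar inE eqxx mvar_neq0.
pose g (p : S) : localization P := to_loc P (sr_pi p).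
have gM p q : g (p * q) = g p * g q by rewrite /g !rmorphM.
have split0 p : proj set0 p = 0 -> g p = g (proj A p) + g (proj (~: A) p).
  move=> p0; have /(congr1 (to_loc P)) : sr_pi (p - (proj A p + proj (~: A) p)) = 0; last first.
    by rewrite !rmorphB !rmorphD rmorph0 /= => /eqP; rewrite subr_eq0 => /eqP.
  apply/sr_pi_eq0 => F /faceA[] FA; rewrite rmorphB rmorphD /= (proj_sub _ FA).
    rewrite proj_proj (_ : F :&: ~: A = set0) ?p0 ?addr0 ?subrr //.
    by apply/eqP; rewrite setI_eq0 -subsets_disjoint.
  rewrite proj_proj (_ : F :&: A = set0) ?p0 ?add0r ?subrr //.
  by apply/eqP; rewrite setI_eq0 disjoints_subset.
have orth p q : proj set0 p = 0 -> proj set0 q = 0 ->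
    g (proj A p) * g (proj (~: A) q) = 0.
  move=> p0 q0; rewrite -gM /g; have -> : sr_pi (proj A p * proj (~: A) q) = 0; last exact: rmorph0.
  apply/sr_pi_eq0 => F /faceA[] FA; rewrite rmorphM /= !proj_proj.
    rewrite (_ : F :&: ~: A = set0) ?q0 ?mulr0 //.
    by apply/eqP; rewrite setI_eq0 -subsets_disjoint.
  rewrite (_ : F :&: A = set0) ?p0 ?mul0r //.
  by apply/eqP; rewrite setI_eq0 disjoints_subset.
(* A multiplier killing the variable vanishes on the face [[set w]], hence at the origin, and so
   lies in [P]. *)
have gvar w : g (mvar K w) != 0.
  apply/eqP => /to_loc_eq0P[r]; have [q <-] := sr_pi_surj r => qP.
  rewrite -rmorphM => /sr_pi_eq0/(_ _ (complex_vertex D w)).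
  rewrite rmorphM /= proj_mvar inE eqxx => /eqP; rewrite mulf_eq0 (negPf (mvar_neq0 K w)) orbF.
  move=> /eqP q0; move: qP; rewrite PE.
  by rewrite (proj_eq0_sub (sub0set _) q0) eqxx.
have mvar0 (w : V) : proj set0 (mvar K w) = 0 by rewrite proj_mvar inE.
have num y : y \in s -> exists2 p, proj set0 p = 0 & exists2 r, r \notin P & to_loc P r * y = g p.
  move=> /snu ny; have [r [t [tP e]]] := loc_num y; have := nonunit_num ny tP e.
  have [p er] := sr_pi_surj r; rewrite -er PE => /eqP p0.
  by exists p => //; exists t => //; rewrite e -er.
pose a := s`_0; pose b := s`_1.
have [p p0 [r rP ra]] := num a (mem_nth 0 (ltnW s2)).
have [q q0 [t tP tb]] := num b (mem_nth 0 s2).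
rewrite split0 // in ra; rewrite split0 // in tb.
have rega y : a * y = 0 -> y = 0.
  move=> ay; have := sreg 0%N (ltnW s2) y; rewrite take0 !gen_ideal_nilP -/a ay eqxx.
  by move=> /(_ isT)/eqP.
have regb y z : b * y = a * z -> exists w, y = w * a.
  move=> byz; have := sreg 1%N s2 y; rewrite -/b byz.
  have -> : take 1 s = [:: a] by rewrite /a; case: (s) s2 => // ? [].
  move=> h; apply/gen_ideal1P/h; apply/gen_ideal1P; exists z; exact: mulrC.
set a1 := g (proj A p) in ra; set a2 := g (proj (~: A) p) in ra.
set b1 := g (proj A q) in tb; set b2 := g (proj (~: A) q) in tb.
have a1b2 : a1 * b2 = 0 by apply: orth.
have b1a2 : b1 * a2 = 0 by apply: orth.
(* The variable of [w] kills [a1], hence also its multiple [a2] and with them [a], against the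
   regularity of [a]. *)
have kill w : w \notin A -> forall e, a2 = e * a1 -> False.
  move=> wA e ea; have /eqP := gvar w; apply; apply: rega.
  have [y yr] := to_loc_unit rP; rewrite -[a]mul1r -yr -(mulrA y) ra ea.
  have a1w : a1 * g (mvar K w) = 0.
    by have := orth p (mvar K w) p0 (mvar0 w); rewrite proj_mvar inE wA.
  by rewrite -{1}[a1]mul1r -mulrDl -!mulrA a1w !mulr0.
have kill' w : w \in A -> forall e, a1 = e * a2 -> False.
  move=> wA e ea; have /eqP := gvar w; apply; apply: rega.
  have [y yr] := to_loc_unit rP; rewrite -[a]mul1r -yr -(mulrA y) ra ea.
  have wa2 : a2 * g (mvar K w) = 0.
    by have := orth (mvar K w) p (mvar0 w) p0; rewrite proj_mvar wA mulrC.
  by rewrite -{2}[a2]mul1r -mulrDl -!mulrA wa2 !mulr0.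
have [x xA] : exists x, x \notin A.
  apply/existsP; rewrite -negb_forall; apply: contraNN AT => /forallP h.
  by apply/eqP/setP => x; rewrite inE h.
have [y xA'] := set0Pn _ A0.
have [[e ae]|[e ae]] := orthogonal_regular_pair (@loc_unit_or _ P) (to_loc_unit rP)
    (to_loc_unit tP) ra tb a1b2 b1a2 regb.
  exact: kill xA e ae.
exact: kill' xA' e ae.
Qed.

End StanleyReisnerRing.

(** * Algebraic dependence in dimension one *)

Section Dimension.

Lemma linear_dependence (K : fieldType) (I J : finType) (f : I -> J -> K) : (#|J| < #|I|)%N ->
  exists2 c : I -> K, exists i, c i != 0 & forall j, \sum_i c i * f i j = 0.
Proof.
move=> JI; pose M := \matrix_(i < #|I|, j < #|J|) f (enum_val i) (enum_val j).
have : kermx M != 0.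
  rewrite kermx_eq0 /row_free; apply: contraTneq JI => <-.
  by rewrite -leqNgt rank_leq_col.
case/rowV0Pn=> r /sub_kermxP rM /rV0Pn[i ri].
exists (fun i => r 0 (enum_rank i)); first by exists (enum_val i); rewrite enum_valK.
move=> j; transitivity ((r *m M) 0 (enum_rank j)); last by rewrite rM mxE.
rewrite mxE.
rewrite (reindex (enum_val : 'I_#|I| -> I)) /=; last first.
  by exists enum_rank => ? _; rewrite ?enum_rankK ?enum_valK.
by apply: eq_bigr => k _; rewrite !mxE enum_rankK enum_valK.
Qed.

(** [q] is the lowest nonzero coefficient of [p], and [i] its exponent. *)
Lemma horner_low_term (A B : comNzRingType) (f : {rmorphism A -> B}) x (p : {poly A}) : p != 0 ->
  exists q i y, q != 0 /\ (map_poly f p).[x] = x ^+ i * (f q + x * y).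
Proof.
elim/poly_ind: p => [|p c IH]; first by rewrite eqxx.
have E : (map_poly f (p * 'X + c%:P)).[x] = (map_poly f p).[x] * x + f c.
  by rewrite rmorphD rmorphM /= map_polyX map_polyC !hornerE.
have [->|c0 _] := eqVneq c 0.
  rewrite addr0 => pX; have [|q [i [y [q0 e]]]] := IH.
    by apply: contraNneq pX => ->; rewrite mul0r.
  by exists q, i.+1, y; split=> //; rewrite rmorphM /= map_polyX hornerM hornerX e exprS; ring.
by exists c, 0%N, (map_poly f p).[x]; split=> //; rewrite E expr0; ring.
Qed.

Lemma horner_morph_sum (A B : comNzRingType) (f : {rmorphism A -> B}) x (cfx : commr_rmorph f x)
  n (E : nat -> A) : horner_morph cfx (\poly_(i < n) E i) = \sum_(i < n) f (E i) * x ^+ i.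
Proof.
rewrite poly_def rmorph_sum; apply: eq_bigr => i _.
by rewrite -mul_polyC rmorphM rmorphXn /= horner_morphC horner_morphX.
Qed.

(** Since [T] is at most 3 (N + 1) (d + 1), the left side is at most 9 n^2 (d + 1)^2 (N + 1)^2, and
    [N] is chosen to make this N (N + 1)^2. *)
Lemma quadratic_lt_cubic n d (N := (9 * n ^ 2 * d.+1 ^ 2)%N) (T := (3 * (N * d + 1))%N) :
  (n * n * T * T < N.+1 * N.+1 * N.+1)%N.
Proof.
have NdT : (N * d + 1 <= N.+1 * d.+1)%N by rewrite mulSn mulnS addn1; lia.
rewrite -[X in (_ < X)%N]mulnA [X in (_ < X)%N]mulSn -[X in (X < _)%N]add0n -addSn.
apply: leq_add; first by rewrite muln_gt0.
apply: (@leq_trans (n * n * (3 * (N.+1 * d.+1)) * (3 * (N.+1 * d.+1)))).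
  by rewrite /T !leq_mul.
by rewrite {3}/N leq_eqVlt; apply/orP; left; apply/eqP; ring.
Qed.

Variables (K : fieldType) (V : finType) (D : simplicial_complex V).
Local Notation S := {mpoly K[#|V|]}.

Lemma msize_mul_leq (p q : S) : (msize (p * q) <= msize p + msize q)%N.
Proof.
have [->|p0] := eqVneq p 0; first by rewrite mul0r mmeasure0.
have [->|q0] := eqVneq q 0; first by rewrite mulr0 mmeasure0.
by rewrite msizeM // leq_pred.
Qed.

Lemma msizeX_le (p : S) d n : (msize p <= d)%N -> (msize (p ^+ n) <= n * d + 1)%N.
Proof.
move=> pd; elim: n => [|n IH]; first by rewrite expr0 -mpolyC1 msizeC oner_eq0.
by rewrite exprS mulSn -addnA (leq_trans (msize_mul_leq _ _)) // leq_add.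
Qed.

(* The (N+1)^3 monomials of degree at most N in each of a, b, c live in a space
   whose dimension is quadratic in N. *)
Lemma SR_dim_le2 (v0 : V) : (forall F, F \in D -> (#|F| <= 2)%N) -> dim_le2 (SR_ring K D).
Proof.
move=> D2 a b c.
have [A eA] := sr_pi_surj a; have [B eB] := sr_pi_surj b; have [C eC] := sr_pi_surj c.
pose d := maxn (msize A) (maxn (msize B) (msize C)).
pose N := (9 * #|V| ^ 2 * d.+1 ^ 2)%N; pose T := (3 * (N * d + 1))%N.
(* With repetitions, the monomials in at most two variables with exponents below [T]; when the two
   vertices coincide, the first exponent counts. *)
pose mono (j : V * V * 'I_T * 'I_T) : 'X_{1..#|V|} :=
  [multinom if (enum_val i : V) == j.1.1.1 then j.1.2 : nat
            else if (enum_val i : V) == j.1.1.2 then j.2 : nat else 0%N | i < #|V|].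
pose Q (i : 'I_N.+1 * 'I_N.+1 * 'I_N.+1) : S := A ^+ i.1.1 * B ^+ i.1.2 * C ^+ i.2.
have [|l [i0 l0] lQ] := @linear_dependence K _ _ (fun i j => (Q i)@_(mono j)).
  by rewrite !card_prod !card_ord; apply: quadratic_lt_cubic.
have Q0 : sr_pi D (\sum_i l i *: Q i) = 0.
  apply/sr_pi_eq0 => F FD; apply/mpolyP => m; rewrite mcoeff_proj mcoeff0.
  case: ifP => // mF; rewrite linear_sum /=.
  (* Each [Q i] has size at most [T], so it has no monomial of degree [T] or more. *)
  have [mT|Tm] := ltnP (mdeg m) T; last first.
    apply: big1 => i _; rewrite mcoeffZ memN_msupp_eq0 ?mulr0 //.
    apply/msize_mdeg_ge/(leq_trans _ Tm).
    have le (k3 : 'I_N.+1) (p : S) : (msize p <= d)%N -> (msize (p ^+ k3) <= N * d + 1)%N.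
      move=> /msizeX_le h; apply: leq_trans (h k3) _.
      by rewrite leq_add2r leq_mul2r -ltnS ltn_ord orbT.
    rewrite /T 2!mulSn mul1n addnA; apply: leq_trans (msize_mul_leq _ _) (leq_add _ _).
      by apply: leq_trans (msize_mul_leq _ _) (leq_add _ _); apply: le; rewrite !leq_max leqnn ?orbT.
    by apply: le; rewrite !leq_max leqnn ?orbT.
  have [u [v muv]] : exists u v, msupport m \subset [set u; v].
    have : (#|msupport m| <= 2)%N by rewrite D2 // (complex_down mF).
    case E : #|msupport m| => [|[|[|//]]] _.
    - by exists v0, v0; rewrite (cards0_eq E) sub0set.
    - have /eqP/cards1P[u ->] := E; exists u, u; rewrite sub1set !inE eqxx //.
    - by have /eqP/cards2P[u [v [_ ->]]] := E; exists u, v.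
  have mlt w : (m (enum_rank w) < T)%N.
    by apply: leq_ltn_trans mT; rewrite mdegE (bigD1 (enum_rank w)) //= leq_addr.
  pose j : V * V * 'I_T * 'I_T := (u, v, Ordinal (mlt u), Ordinal (mlt v)).
  have -> : m = mono j.
    apply/mnmP => i; rewrite mnmE /=.
    case: eqP => [<-|/eqP iu]; first by rewrite enum_valK.
    case: eqP => [<-|/eqP iv]; first by rewrite enum_valK.
    have : (enum_val i : V) \notin msupport m.
      by apply: contra (fun h => subsetP muv _ h) _; rewrite !inE negb_or iu.
    by rewrite inE enum_valK negbK => /eqP.
  by rewrite -[RHS](lQ j); apply: eq_bigr => i _; rewrite mcoeffZ.
pose k : {rmorphism K -> SR_ring K D} := @sr_pi K V D \o @mpolyC #|V| K.
pose e1 : {rmorphism {poly K} -> SR_ring K D} := horner_morph (fun t : K => mulrC c (k t)).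
pose e2 : {rmorphism {poly {poly K}} -> SR_ring K D} := horner_morph (fun t => mulrC b (e1 t)).
pose e3 : {rmorphism {poly {poly {poly K}}} -> SR_ring K D} :=
  horner_morph (fun t => mulrC a (e2 t)).
pose L (x y z : nat) := l (inord x, inord y, inord z).
pose q1 x y := \poly_(z < N.+1) L x y z.
pose q2 x := \poly_(y < N.+1) q1 x y.
pose q3 := \poly_(x < N.+1) q2 x.
have q3n0 : q3 != 0.
  apply: contraNneq l0 => q0; case: i0 => [[x y] z].
  have : ((q3`_x)`_y)`_z = 0 by rewrite q0 !coef0.
  by rewrite /q3 coef_poly ltn_ord /q2 coef_poly ltn_ord /q1 coef_poly ltn_ord /L !inord_val => ->.
have e3q : e3 q3 = 0.
  rewrite -Q0 rmorph_sum /=.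
  transitivity (\sum_(x < N.+1) \sum_(y < N.+1) \sum_(z < N.+1)
      sr_pi D (l (x, y, z) *: Q (x, y, z))); last first.
    by rewrite pair_bigA /= pair_bigA /=; apply: eq_bigr => -[[x y] z] _.
  rewrite [LHS]horner_morph_sum; apply: eq_bigr => x _.
  rewrite [e2 _]horner_morph_sum mulr_suml; apply: eq_bigr => y _.
  rewrite [e1 _]horner_morph_sum !mulr_suml; apply: eq_bigr => z _.
  rewrite /L !inord_val -mul_mpolyC !rmorphM !rmorphXn /= eA eB eC.
  by rewrite -!mulrA; congr (_ * _); rewrite mulrA mulrC; congr (_ * _); rewrite mulrC.
(* Lowest terms are taken in [a], then [b], then [c]; what remains is a nonzero constant [t], and
   dividing by it produces the 1 of [dim_le2]. *)
have [r1 [i [x [r1n0 E1]]]] := @horner_low_term _ _ e2 a q3 q3n0.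
have [r2 [j [y [r2n0 E2]]]] := @horner_low_term _ _ e1 b r1 r1n0.
have [t [n [z [tn0 E3]]]] := @horner_low_term _ _ k c r2 r2n0.
have kt : k t^-1 * k t = 1 by rewrite -rmorphM mulVf ?rmorph1.
exists i, j, n, (k t^-1 * x), (k t^-1 * y), (k t^-1 * z).
transitivity (k t^-1 * e3 q3); last by rewrite e3q mulr0.
rewrite [e3 q3]E1 [e2 r1]E2 [e1 r2]E3 -[X in X + c * _]kt.
move: (k t^-1) (k t) => w w'; ring.
Qed.
End Dimension.

(** * Connected graphs *)

Section Evaluation.
Variables (K : fieldType) (n : nat).
Local Notation S := {mpoly K[n]}.

Definition mpoly_ev (p : {poly K}) (x : S) : S := (map_poly (@mpolyC n K) p).[x].

Lemma rmorph_mpoly_ev (B : comNzRingType) (f : {rmorphism S -> B}) p x :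
  f (mpoly_ev p x) = (map_poly (f \o @mpolyC n K) p).[f x].
Proof. by rewrite /mpoly_ev -horner_map -map_poly_comp. Qed.

Lemma mpoly_rmorph_ext (B : comNzRingType) (f g : {rmorphism S -> B}) :
    (forall c, f c%:MP = g c%:MP) -> (forall i, f 'X_i = g 'X_i) -> f =1 g.
Proof.
move=> fgC fgX p; rewrite [p]mpolyE !rmorph_sum; apply: eq_bigr => m _.
rewrite -mul_mpolyC !rmorphM fgC mpolyXE_id !rmorph_prod; congr (_ * _).
by apply: eq_bigr => i _; rewrite !rmorphXn fgX.
Qed.

(** Sending every variable to ['X] recovers [p]. *)
Lemma mpoly_ev_var_neq0 p i : p != 0 -> mpoly_ev p 'X_i != 0.
Proof.
pose f : {rmorphism S -> {poly K}} := mmap (@polyC K) (fun=> 'X).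
apply: contraNneq => /(congr1 f); rewrite rmorph0 rmorph_mpoly_ev.
have -> : f 'X_i = 'X by rewrite /= mmapX mmap1U.
have -> : map_poly (f \o @mpolyC n K) p = map_poly polyC p.
  by apply: eq_map_poly => c; apply: mmapC.
by rewrite -/(comp_poly _ _) comp_polyXr => ->.
Qed.

End Evaluation.

(* Division by Q, whose leading coefficient is a unit, shows that a constant p
   dividing Q g divides g. *)
Lemma polyC_dvd_mul (A : idomainType) (p : A) (Q g h : {poly A}) :
  lead_coef Q \is a GRing.unit -> Q * g = p%:P * h -> exists k, g = p%:P * k.
Proof.
move=> uQ e; exists (h %/ Q); apply/eqP; rewrite -subr_eq0; apply/negPn/negP => d0.
have Q0 : Q != 0 by apply: contraTneq uQ => ->; rewrite lead_coef0 unitr0.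
(* The right side is smaller in size than [Q], which a nonzero multiple of [Q] cannot be. *)
have eQ : Q * (g - p%:P * (h %/ Q)) = p *: (h %% Q).
  rewrite mulrBr e {1}(Pdiv.IdomainUnit.divp_eq uQ h) -mul_polyC; ring.
have : (size (h %% Q)%R < size Q)%N by rewrite ltn_modp.
apply/negP; rewrite -leqNgt; apply: leq_trans (size_scale_leq p _); rewrite -eQ.
have := d0; rewrite size_mul // -size_poly_gt0.
by case: (size (g - _)) => // m _; rewrite addnS leq_addr.
Qed.

Lemma integral_cubic (A L : comNzRingType) (f : {rmorphism A -> L}) (x t e : L) :
    integralOver f t -> integralOver f e -> x ^+ 3 - t * x ^+ 2 + e * x = 0 ->
  integralOver f x.
Proof.
move=> intt inte x0; pose s := [:: 0; e; - t; 1].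
have sE : Poly s = s :> seq L by apply: (@PolyK _ 0); rewrite /= oner_neq0.
apply: (@integral_root_monic _ _ _ _ (Poly s)).
- by rewrite monicE lead_coefE sE.
- by apply/rootP; rewrite /horner sE /= -[RHS]x0; ring.
- move=> y; rewrite sE !inE => /or4P[]/eqP->; [exact: integral0| |exact: integral_opp|exact: integral1].
  exact: inte.
Qed.

Lemma integral_mpoly (K : fieldType) n (A L : comNzRingType) (f : {rmorphism A -> L})
    (h : {rmorphism {mpoly K[n]} -> L}) :
    (forall c, integralOver f (h c%:MP)) -> (forall i, integralOver f (h 'X_i)) ->
  forall p, integralOver f (h p).
Proof.
move=> intC intX p; rewrite [p]mpolyE rmorph_sum.
elim/big_ind: _ => [|u v|m _]; [exact: integral0|exact: integral_add|].
rewrite -mul_mpolyC rmorphM; apply: integral_mul (intC _) _.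
rewrite mpolyXE_id rmorph_prod; elim/big_ind: _ => [|u v|i _]; first exact: integral1.
  exact: integral_mul.
rewrite rmorphXn; elim: (m i) => [|k IH]; first exact: integral1.
by rewrite exprS; apply: integral_mul.
Qed.

(** * Gluing polynomials given on the facets *)

Section Gluing.
Variables (K : fieldType) (V : finType) (D : simplicial_complex V).
Local Notation S := {mpoly K[#|V|]}.

(** The coefficient of [W] at a monomial is read off from any facet containing its support;
    compatibility makes the choice immaterial, and [k] bounds all degrees that occur. *)
Lemma glue_facets (w : {set V} -> S) :
    (forall F G, F \in facets D -> G \in facets D -> proj (F :&: G) (w F) = proj (F :&: G) (w G)) ->
  exists W, forall F, F \in facets D -> proj F W = proj F (w F).
Proof.
move=> wE; pose k := (\max_(F in facets D) msize (w F))%N.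
pose E (m : 'X_{1..#|V|}) :=
  if [pick F in facets D | msupport m \subset F] is Some F then (w F)@_m else 0.
exists (\sum_(m : 'X_{1..#|V| < k}) E m *: 'X_[m]) => F FD; apply/mpolyP => m.
rewrite !mcoeff_proj; case: ifP => // mF; have [mk|km] := ltnP (mdeg m) k.
  rewrite (mcoeff_mpoly _ mk) /E; case: pickP => [G /andP[GD mG]|/(_ F)]; last by rewrite FD mF.
  have := congr1 (mcoeff m) (wE _ _ FD GD).
  by rewrite !mcoeff_proj subsetI mF mG.
rewrite memN_msupp_eq0; last first.
  apply/msize_mdeg_ge/(leq_trans _ km)/(leq_trans (msize_sum _ _ _))/bigmax_leqP => m' _.
  by apply: leq_trans (msizeZ_le _ _) _; rewrite mmeasureX bmdeg.
rewrite memN_msupp_eq0 //; apply/msize_mdeg_ge/(leq_trans _ km).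
exact: (leq_bigmax_cond (F := fun F => msize (w F))).
Qed.

End Gluing.

(** * Regular parameters on a connected graph *)

Section Graph.
Variables (K : fieldType) (V : finType) (D : simplicial_complex V).
Hypothesis D2 : forall F, F \in D -> (#|F| <= 2)%N.
Hypothesis Dconn : cut_connected D.
Hypothesis V2 : (1 < #|V|)%N.
Local Notation S := {mpoly K[#|V|]}.
Local Notation R := (SR_ring K D).

(** The cut around a single vertex is crossed by an edge, so neither a vertex nor the empty face is
    maximal. *)
Lemma facet_edge F : F \in facets D -> exists u v, u != v /\ F = [set u; v].
Proof.
rewrite inE => /maxsetP[/= FD maxF]; apply/cards2P; rewrite eqn_leq D2 //= leqNgt.
apply/negP; rewrite ltnS leq_eqVlt ltnS leqn0 => /orP[/cards1P[v Fv]|].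
  have [||u [w [uv wv uwD]]] := @Dconn [set v].
  - by apply/set0Pn; exists v; rewrite inE.
  - by apply: contraTneq V2 => vT; rewrite -cardsT -vT cards1.
  have := maxF _ uwD; move: uv; rewrite inE Fv => /eqP->.
  rewrite sub1set !inE eqxx => /(_ isT)/setP/(_ w).
  by rewrite !inE eqxx orbT; move: wv; rewrite inE => /negPf->.
rewrite cards_eq0 => /eqP F0; have /card_gt0P[v _] := ltnW V2.
by have := maxF _ (complex_vertex D v); rewrite F0 sub0set => /(_ isT)/setP/(_ v); rewrite !inE eqxx.
Qed.

Definition theta : S := \sum_v mvar K v.
Definition eta : S := \sum_(F in facets D) squarefree_mon K F.

Lemma proj_theta u v : u != v -> proj [set u; v] theta = mvar K u + mvar K v.
Proof.
move=> uv; rewrite rmorph_sum /= (bigD1 u) //= (bigD1 v) 1?eq_sym //= big1 => [|w /andP[wu wv]].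
  by rewrite !proj_mvar !inE !eqxx orbT addr0.
by rewrite proj_mvar !inE (negPf wu) (negPf wv).
Qed.

Lemma proj_eta u v : u != v -> [set u; v] \in facets D ->
  proj [set u; v] eta = mvar K u * mvar K v.
Proof.
move=> uv FD; rewrite rmorph_sum /= (bigD1 [set u; v]) //= big1 => [|G /andP[GD GF]].
  rewrite proj_squarefree subxx addr0 /squarefree_mon big_setU1 ?inE //=.
  by rewrite big_set1.
rewrite proj_squarefree; case: ifP => // GuV; case/negP: GF.
have [x [y [xy eG]]] := facet_edge GD.
by rewrite eqEcard GuV eG !cards2 uv xy.
Qed.

(** On an edge, [theta] and [eta] restrict to the sum and the product of its two variables, which
    are thus roots of X^2 - theta X + eta; the extra factor [mvar K v] settles the edges that miss
    [v]. *)
Lemma mvar_cubic v :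
  sr_pi D (mvar K v ^+ 3 - theta * mvar K v ^+ 2 + eta * mvar K v) = 0.
Proof.
apply/sr_pi_eq0/SR_idealP/SR_ideal_facets => F FD.
have [x [y [xy eF]]] := facet_edge FD; rewrite eF in FD *.
rewrite !(rmorphD, rmorphN, rmorphM, rmorphXn) /= proj_theta // proj_eta // proj_mvar !inE.
by case: (eqVneq v x) => [->|_] /=; [|case: (eqVneq v y) => [->|_] /=]; ring.
Qed.

(** By [mvar_cubic] the residue field is integral over any subring containing [K] and the classes of
    [theta] and [eta]; [algebraic_of_integral] is then used twice, with the two exchanged. *)
Lemma parameters_algebraic (M : prime_idealr R) : maximal_ideal M ->
  exists p q : {poly K}, [/\ p != 0, q != 0, sr_pi D (mpoly_ev p theta) \in M &
    sr_pi D (mpoly_ev q eta) \in M].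
Proof.
move=> [_ maxM]; pose L : comNzRingType := {ideal_quot M}.
pose piL : {rmorphism R -> L} := \pi_L.
have piL0 r : (piL r == 0) = (r \in M).
  by rewrite -(rmorph0 piL) /= -Quotient.idealrBE subr0.
pose h : {rmorphism S -> L} := piL \o @sr_pi K V D.
have hsurj y : exists p, h p = y.
  have [p ep] := sr_pi_surj (repr y : R); exists p.
  by rewrite /= ep reprK.
have fieldL (y : L) : y != 0 -> exists z, z * y = 1.
  have [p <-] := hsurj y; rewrite [h p == 0]piL0 => pM.
  pose I : {pred R} := [pred x | `[< exists t m, m \in M /\ x = t * sr_pi D p + m >]].
  have [/asboolP[t [m [mM e1]]]|nI1] := boolP (1 \in I).
    exists (piL t); rewrite -[h p]/(piL (sr_pi D p)) -rmorphM -(rmorph1 piL) e1 rmorphD.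
    have /eqP m0 : piL m == 0 by rewrite piL0.
    by rewrite [X in _ + X]m0 addr0.
  case/negP: pM; apply: (maxM I); last by apply/asboolP; exists 1, 0; rewrite idealr0 mul1r addr0.
    split=> //; first by apply/asboolP; exists 0, 0; rewrite idealr0 mul0r addr0.
    move=> a u v /asboolP[t [m [mM ->]]] /asboolP[t' [m' [mM' ->]]]; apply/asboolP.
    by exists (a * t + t'), (a * m + m'); rewrite rpredD ?idealMr //; split=> //; ring.
  by move=> x xM; apply/asboolP; exists 0, x; rewrite mul0r add0r.
have intL (A : comNzRingType) (f : {rmorphism A -> L}) :
    (forall c, integralOver f ((h \o @mpolyC #|V| K) c)) ->
    integralOver f (h theta) -> integralOver f (h eta) -> forall y, integralOver f y.
  move=> intK intt inte y; have [p <-] := hsurj y.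
  have intv i : integralOver f (h 'X_i).
    apply: (integral_cubic intt inte).
    have := congr1 piL (mvar_cubic (enum_val i)); rewrite rmorph0 /mvar enum_valK.
    by rewrite -[piL _]/(h _) rmorphD rmorphB (rmorphM h theta) (rmorphM h eta) !rmorphXn.
  exact: (integral_mpoly intK intv).
have [p p0 hp] := algebraic_of_integral fieldL intL.
have [q q0 hq] := algebraic_of_integral fieldL (fun A f iK ie it => intL A f iK it ie).
exists p, q; split=> //; rewrite -piL0 -[piL _]/(h _) rmorph_mpoly_ev; exact/eqP.
Qed.

Variables (p q : {poly K}).
Hypotheses (p0 : p != 0) (q0 : q != 0).

Lemma proj_parameter_neq0 (F : {set V}) v : v \in F -> proj F (mpoly_ev p theta) != 0.
Proof.
move=> vF; apply/eqP => h; have := proj_eq0_sub (_ : [set v] \subset F) h.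
rewrite sub1set => /(_ vF)/eqP; apply/negP.
rewrite rmorph_mpoly_ev; have vt : proj [set v] theta = mvar K v.
  rewrite rmorph_sum /= (bigD1 v) //= big1 => [|w wv].
    by rewrite proj_mvar inE eqxx addr0.
  by rewrite proj_mvar inE (negPf wv).
have vp : map_poly (proj [set v] \o @mpolyC #|V| K) p = map_poly (@mpolyC #|V| K) p.
  by apply: eq_map_poly => c; apply: projC.
rewrite [X in X.[_]]vp [X in _.[X]]vt.
exact: mpoly_ev_var_neq0.
Qed.

(* On the face {u, v}, in the coordinates s = x_u + x_v and x = x_u, the
   parameters become p(s) and q(x (s - x)), the latter with a unit as leading
   coefficient in x. *)
Lemma edge_divides g h F : F \in facets D ->
    sr_pi D (mpoly_ev q eta * g) = sr_pi D (mpoly_ev p theta * h) ->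
  exists w, proj F w = w /\ proj F g = proj F (mpoly_ev p theta) * w.
Proof.
move=> FD e; have [u [v [uv eF]]] := facet_edge FD.
pose B := {poly {poly K}}; pose s : B := ('X : {poly K})%:P.
(* The change of coordinates on the face; [psi] below inverts it up to [proj F]. *)
pose phi : {rmorphism S -> B} := mmap (@polyC {poly K} \o @polyC K) (fun i =>
  if (enum_val i : V) == u then 'X else if (enum_val i : V) == v then s - 'X else 0).
have phiC c : phi c%:MP = c%:P%:P by rewrite /= mmapC.
have phiX i : phi 'X_i = if (enum_val i : V) == u then 'X else
    if (enum_val i : V) == v then s - 'X else 0 by rewrite /= mmapX mmap1U.
have phi_proj x : phi (proj F x) = phi x.
  apply: (@mpoly_rmorph_ext _ _ _ (phi \o proj F) phi) => [c|i] /=; first by rewrite projC.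
  have := proj_mvar K F (enum_val i); rewrite /mvar enum_valK => ->.
  rewrite eF !inE; case: ifP => // /negbT; rewrite negb_or => /andP[iu iv].
  by rewrite [RHS]phiX (negPf iu) (negPf iv) rmorph0.
pose E1 : {rmorphism {poly K} -> S} :=
  horner_morph (fun c => mulrC (mvar K u + mvar K v) (@mpolyC #|V| K c)).
pose psi : {rmorphism B -> S} := horner_morph (fun t => mulrC (mvar K u) (E1 t)).
have E1C c : E1 c%:P = c%:MP by rewrite /= horner_morphC.
have E1X : E1 'X = mvar K u + mvar K v by rewrite /= horner_morphX.
have psiC t : psi t%:P = E1 t by rewrite /= horner_morphC.
have psiX : psi 'X = mvar K u by rewrite /= horner_morphX.
have psi_phi x : psi (phi x) = proj F x.
  apply: (@mpoly_rmorph_ext _ _ _ (psi \o phi) (proj F)) => [c|i].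
    transitivity (psi c%:P%:P); first by rewrite -phiC.
    by rewrite [RHS]projC psiC E1C.
  have projX : proj F ('X_i : S) = if (enum_val i : V) \in F then 'X_i else 0.
    by have := proj_mvar K F (enum_val i); rewrite /mvar enum_valK.
  transitivity (psi (if (enum_val i : V) == u then 'X else
    if (enum_val i : V) == v then s - 'X else 0)); first by rewrite -phiX.
  transitivity (if (enum_val i : V) \in F then 'X_i else 0 : S); last by rewrite -projX.
  rewrite eF !inE.
  case: (eqVneq (enum_val i : V) u) => [iu|_]; first by rewrite psiX -iu /mvar enum_valK.
  case: (eqVneq (enum_val i : V) v) => [iv|_]; last by rewrite rmorph0.
  by rewrite rmorphB psiC E1X psiX addrAC subrr add0r -iv /mvar enum_valK.
have phi_theta : phi (mpoly_ev p theta) = p%:P.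
  rewrite rmorph_mpoly_ev -phi_proj eF proj_theta // rmorphD !phiX !enum_rankK !eqxx.
  rewrite eq_sym (negPf uv) addrC subrK.
  have -> : map_poly (phi \o @mpolyC #|V| K) p = map_poly polyC (map_poly polyC p).
    by rewrite -map_poly_comp; apply: eq_map_poly => c; apply: phiC.
  by rewrite horner_map /= -/(comp_poly _ _) comp_polyXr.
(* ['X * (s - 'X)] has leading coefficient -1, so up to sign this is the leading coefficient of [q],
   a nonzero constant. *)
have uQ : lead_coef (phi (mpoly_ev q eta)) \is a GRing.unit.
  have FD' : [set u; v] \in facets D by rewrite -eF.
  rewrite rmorph_mpoly_ev -phi_proj eF proj_eta // rmorphM !phiX !enum_rankK !eqxx.
  rewrite eq_sym (negPf uv).
  have -> : map_poly (phi \o @mpolyC #|V| K) q = map_poly polyC (map_poly polyC q).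
    by rewrite -map_poly_comp; apply: eq_map_poly => c; apply: phiC.
  have lX : lead_coef (s - 'X) = -1.
    by rewrite -opprB lead_coefN lead_coefXsubC.
  have sX : size (s - 'X) = 2%N by rewrite -opprB size_polyN size_XsubC.
  rewrite -/(comp_poly _ _) lead_coef_comp; last first.
    by rewrite size_mul ?polyX_eq0 -?size_poly_eq0 ?sX // size_polyX.
  rewrite lead_coefM lX lead_coefX mul1r unitrM unitrX ?unitrN1 // andbT.
  rewrite (lead_coef_map_inj (@polyC_inj K) (rmorph0 _)).
  by rewrite rmorph_unit // unitfE lead_coef_eq0.
have [|k gk] := @polyC_dvd_mul _ p (phi (mpoly_ev q eta)) (phi g) (phi h) uQ.
  rewrite -phi_theta -!rmorphM -phi_proj -[RHS]phi_proj; congr (phi _).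
  move/eqP: e; rewrite -subr_eq0 -rmorphB => /eqP/sr_pi_eq0/(_ F).
  have FD' : F \in D by move: FD; rewrite inE => /maxsetP[].
  by move=> /(_ FD')/eqP; rewrite rmorphB subr_eq0 => /eqP.
exists (proj F (psi k)); rewrite proj_sub //; split=> //.
by rewrite -{1}(proj_sub g (subxx F)) -(psi_phi g) gk -phi_theta rmorphM psi_phi rmorphM /= proj_sub.
Qed.

(** On every facet [p] at [theta] restricts to a nonzero element of a domain. *)
Lemma theta_regular g : sr_pi D (mpoly_ev p theta * g) = 0 -> sr_pi D g = 0.
Proof.
move=> /sr_pi_eq0 e; apply/sr_pi_eq0/SR_idealP/SR_ideal_facets => F FD.
have FD' : F \in D by move: FD; rewrite inE => /maxsetP[].
have [u [v [_ eF]]] := facet_edge FD; have uF : u \in F by rewrite eF !inE eqxx.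
have /eqP := e _ FD'; rewrite rmorphM mulf_eq0 (negPf (proj_parameter_neq0 uF)).
by move/eqP.
Qed.

Lemma eta_regular g h : sr_pi D (mpoly_ev q eta * g) = sr_pi D (mpoly_ev p theta * h) ->
  exists W, sr_pi D g = sr_pi D (mpoly_ev p theta * W).
Proof.
move=> e.
have /boolp.choice[w wP] (F : {set V}) : exists w, F \in facets D ->
    proj F w = w /\ proj F g = proj F (mpoly_ev p theta) * w.
  have [FD|_] := boolP (F \in facets D); last by exists 0.
  by have [w wP] := edge_divides FD e; exists w.
have meet (F G : {set V}) v : F \in facets D -> G \in facets D -> v \in F -> v \in G ->
    proj (F :&: G) (w F) = proj (F :&: G) (w G).
  move=> FD GD vF vG; have [_ gF] := wP F FD; have [_ gG] := wP G GD.
  have vFG : v \in F :&: G by rewrite inE vF.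
  apply: (mulfI (proj_parameter_neq0 vFG)).
  have cut (H : {set V}) : F :&: G \subset H -> proj H g = proj H (mpoly_ev p theta) * w H ->
      proj (F :&: G) (mpoly_ev p theta) * proj (F :&: G) (w H) = proj (F :&: G) g.
    by move=> sH gH; rewrite -(proj_sub g sH) gH rmorphM /= (proj_sub _ sH).
  by rewrite !cut ?subsetIl ?subsetIr.
(* [A] collects the vertices on some facet whose quotient has the same constant term as [w F]; no
   edge leaves it, so it contains every vertex. *)
have const (F G : {set V}) : F \in facets D -> G \in facets D -> proj set0 (w F) = proj set0 (w G).
  move=> FD GD; pose A := [set v | [exists H in facets D,
    (v \in H) && (proj set0 (w H) == proj set0 (w F))]].
  have meet0 (H H' : {set V}) v : H \in facets D -> H' \in facets D -> v \in H -> v \in H' ->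
      proj set0 (w H) = proj set0 (w H').
    move=> HD HD' vH vH'; have := congr1 (proj set0) (meet _ _ _ HD HD' vH vH').
    by rewrite !proj_sub ?sub0set.
  have AT : A = setT.
    apply/eqP/negPn/negP => /(Dconn _)[|u [v [uA vA uvD]]].
      have [u [v [_ eF]]] := facet_edge FD; apply/set0Pn; exists u; rewrite inE.
      by apply/existsP; exists F; rewrite FD eqxx eF !inE eqxx.
    have [H HD uvH] := sub_facet uvD; case/negP: vA.
    have [uH vH] : u \in H /\ v \in H.
      by split; apply: (subsetP uvH); rewrite !inE eqxx ?orbT.
    move: uA; rewrite !inE => /existsP[H' /and3P[HD' uH' /eqP <-]].
    by apply/existsP; exists H; rewrite HD vH (meet0 H H' u) ?eqxx.
  have [u [v [_ eG]]] := facet_edge GD; have uG : u \in G by rewrite eG !inE eqxx.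
  have : u \in A by rewrite AT inE.
  rewrite inE => /existsP[H /and3P[HD uH /eqP <-]]; exact: (meet0 _ _ u).
have [|W WP] := @glue_facets K V D w.
  move=> F G FD GD; have [FG0|[v]] := set_0Vmem (F :&: G); first by rewrite FG0 (const F G).
  by rewrite inE => /andP[]; apply: meet.
exists W; apply/eqP; rewrite -subr_eq0 -rmorphB; apply/eqP/sr_pi_eq0/SR_idealP/SR_ideal_facets.
by move=> F FD; have [wF gF] := wP F FD; rewrite rmorphB rmorphM /= WP // wF gF subrr.
Qed.

End Graph.

Lemma connected_graph_cohen_macaulay (K : fieldType) (V : finType) (D : simplicial_complex V) :
    (forall F, F \in D -> (#|F| <= 2)%N) -> cut_connected D -> (1 < #|V|)%N ->
  cohen_macaulay (SR_ring K D).
Proof.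
move=> D2 Dconn V2; split; first exact: (noetherian_mpoly_surj (@sr_pi_surj K V D)).
move=> M maxM; have /card_gt0P[v0 _] := ltnW V2.
have [p [q [p0 q0 pM qM]]] := parameters_algebraic D2 Dconn V2 maxM.
refine (@local_cohen_macaulay_dim2 _ M _ _ (SR_dim_le2 (K := K) v0 D2) pM qM _ _).
  move=> x; have [g <-] := sr_pi_surj x; rewrite -rmorphM.
  exact: (theta_regular D2 Dconn V2 p0).
move=> x y; have [g <-] := sr_pi_surj x; have [h <-] := sr_pi_surj y.
rewrite -!rmorphM => /(eta_regular D2 Dconn V2 p0 q0)[W ->].
by exists (sr_pi D W); rewrite rmorphM.
Qed.

(** * Expansions *)

Section ExpansionGraph.
Variables (n : nat) (D : simplicial_complex 'I_n) (s : 'I_n -> nat).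
Hypothesis s_gt0 : forall i, (0 < s i)%N.
Local Notation vert := (@Tagged _ _ (fun i => 'I_(s i))).

Lemma expansion_face_card k (F : {set exp_vertex s}) :
  (forall G : {set 'I_n}, G \in D -> (#|G| <= k)%N) -> F \in expansion D s_gt0 -> (#|F| <= k)%N.
Proof.
move=> Dk; rewrite inE => /existsP[G /andP[/exp_facetsP[H HD [r ->]] FG]].
apply: leq_trans (subset_leq_card FG) (leq_trans (leq_imset_card _ _) (Dk _ _)).
by move: HD; rewrite inE => /maxsetP[].
Qed.

(** A facet through [i] and [j] is lifted by a choice of copies prescribed at both; as [i] and [j]
    differ, the second update keeps the first. *)
Lemma expansion_edge i j (r : 'I_(s i)) (t : 'I_(s j)) : i != j -> [set i; j] \in D ->
  [set vert r; vert t] \in expansion D s_gt0.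
Proof.
move=> ij /sub_facet[H HD ijH]; rewrite inE; apply/existsP.
pose f := dfwith (dfwith (fun k => Ordinal (s_gt0 k)) r) t.
exists [set Tagged _ (f k) | k in H]; apply/andP; split.
  by apply/exp_facetsP; exists H => //; exists f.
rewrite subUset !sub1set; apply/andP; split; apply/imsetP.
  exists i; first by apply: (subsetP ijH); rewrite !inE eqxx.
  by rewrite /f dfwith_out 1?eq_sym // dfwith_in.
exists j; first by apply: (subsetP ijH); rewrite !inE eqxx orbT.
by rewrite /f dfwith_in.
Qed.

(** A set that no edge leaves is a union of full fibres over the vertices of [D], so it comes from a
    set of vertices that no edge of [D] leaves. *)
Lemma expansion_connected : (1 < n)%N -> cut_connected D -> cut_connected (expansion D s_gt0).
Proof.
move=> n2 Dconn A A0 AT; apply: contrapT => ncut.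
have cross i j (r : 'I_(s i)) (t : 'I_(s j)) : i != j -> [set i; j] \in D ->
    vert r \in A -> vert t \in A.
  move=> ij ijD rA; apply: contrapT => /negP tA; apply: ncut.
  by exists (vert r), (vert t); split=> //; apply: expansion_edge.
(* Two copies of [i] are never adjacent; they are joined through a copy of a neighbour [j] of
   [i]. *)
have same i (r r' : 'I_(s i)) : vert r \in A -> vert r' \in A.
  move=> rA; have [||k [j [ki ji ijD]]] := Dconn [set i].
  - by apply/set0Pn; exists i; rewrite inE.
  - by apply: contraTneq n2 => iT; rewrite -[n]card_ord -cardsT -iT cards1.
  move: ki ji ijD; rewrite !inE => /eqP-> ji ijD.
  have ij : i != j by rewrite eq_sym.
  apply: (cross j i (Ordinal (s_gt0 j))) => //; first by rewrite setUC.
  exact: cross ij ijD rA.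
have [||i [j [iB jB ijD]]] := Dconn [set i | [exists r : 'I_(s i), vert r \in A]].
- have /set0Pn[[i r] rA] := A0; apply/set0Pn; exists i; rewrite inE.
  by apply/existsP; exists r.
- apply: contraNneq AT => BT; apply/eqP/setP => -[i r]; rewrite [RHS]inE.
  have : i \in [set: 'I_n] by rewrite inE.
  by rewrite -BT inE => /existsP[r' /same]; apply.
case/negP: jB; move: iB; rewrite !inE => /existsP[r rA].
apply/existsP; exists (Ordinal (s_gt0 j)).
have [<-|ij] := eqVneq i j; first exact: same rA.
exact: cross ij ijD rA.
Qed.

End ExpansionGraph.

Theorem corollary2p15 (K : fieldType) (n : nat) (D : simplicial_complex 'I_n)
  (D_dim1 : complex_dim D = 1) (D_CM : cohen_macaulay_over K D)
  (s : 'I_n -> nat) (s_gt0 : forall i : 'I_n, (0 < s i)%N) :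
  cohen_macaulay_over K (expansion D s_gt0).
Proof.
have maxD : (\max_(F in faces D) #|F|)%N = 2%N.
  by move/eqP: D_dim1; rewrite /complex_dim subr_eq => /eqP[].
have D2 F : F \in D -> (#|F| <= 2)%N.
  by move=> FD; rewrite -maxD; apply: (leq_bigmax_cond (F := fun F : {set 'I_n} => #|F|)).
have D0 : (0 < #|faces D|)%N by apply/card_gt0P; exists set0; apply: complex_set0.
have [E ED maxE] := eq_bigmax_cond (fun F : {set 'I_n} => #|F|) D0.
rewrite maxD in maxE.
have n2 : (1 < n)%N by rewrite maxE -[n in (_ <= n)%N]card_ord max_card.
have Dconn : cut_connected D.
  by apply: cohen_macaulay_connected D_CM; exists E.
apply: connected_graph_cohen_macaulay.
- by move=> F; apply: expansion_face_card.
- exact: expansion_connected.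
pose v0 (i : 'I_n) : exp_vertex s := Tagged _ (Ordinal (s_gt0 i)).
by apply/card_gt1P; exists (v0 (Ordinal (ltnW n2))), (v0 (Ordinal n2)).
Qed.
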